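(* Consider a linear-polyhedral multistage stochastic problem, with sets $X_t$, set-valued mappings $\mathcal U_t^w$, Bellman operators, value functions $V_t$ and constants $L_{V_t}$ as described in the context. Assume that the noises $\mathbf W_1,\dots,\mathbf W_T$ are independent with finite supports, that $X_t$ is nonempty and compact for every $t\in\{0,\dots,T\}$, and that $\mathcal U_t^w(x)$ is nonempty and compact for every $t\in\{0,\dots,T-1\}$, $w\in\mathrm{supp}(\mathbf W_{t+1})$ and $x\in X_t$. Then for every $t\in\{0,\dots,T\}$ the mapping $\underline S_t^{\mathrm{SDDP}}$ defined in the context is a selection function (for lower approximations), i.e.: - for $t=T$: $\underline S_T^{\mathrm{SDDP}}$ maps $X_T$ to $\underline{\mathbf F}_T^{\mathrm{SDDP}}$ and, for every $x\in X_T$, $\underline S_T^{\mathrm{SDDP}}(x)(x)=V_T(x)$ (tightness) and $\underline S_T^{\mathrm{SDDP}}(x)\le V_T$ (validity); - for $t<T$: $\underline S_t^{\mathrm{SDDP}}$ maps $\mathcal P(\underline{\mathbf F}_{t+1}^{\mathrm{SDDP}})\times X_t$ to $\underline{\mathbf F}_t^{\mathrm{SDDP}}$ and, for every set $F\subset\underline{\mathbf F}_{t+1}^{\mathrm{SDDP}}$ and every $x\in X_t$, $\underline S_t^{\mathrm{SDDP}}(F,x)(x)=\mathfrak B_t(\underline{\mathcal V}_F)(x)$ (tightness) and $\underline S_t^{\mathrm{SDDP}}(F,x)\le\mathfrak B_t(\underline{\mathcal V}_F)$ (validity), where $\underline{\mathcal V}_F=\sup_{\phi\in F}\phi$ pointw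ise.
   Context: $T\ge1$, $\mathbb X=\mathbb R^n$, $\mathbb U=\mathbb R^m$ with Euclidean norms, $\overline{\mathbb R}=\mathbb R\cup\{\pm\infty\}$; $\mathcal P(Z)$ is the power set of $Z$. $\mathbf W_t$ ($t=1,\dots,T$) is a random variable with finite support $\mathrm{supp}(\mathbf W_t)=\{w:\mathbb P(\mathbf W_t=w)>0\}$; for $w\in\mathrm{supp}(\mathbf W_{t+1})$ write $p_w=\mathbb P(\mathbf W_{t+1}=w)$. Linear-polyhedral problem: for $t\in\{0,\dots,T-1\}$ and $w\in\mathrm{supp}(\mathbf W_{t+1})$, the dynamics are $f_t^w(x,u)=A_t^wx+B_t^wu$ for matrices $A_t^w,B_t^w$ of suitable dimensions, and the cost is $$c_t^w(x,u)=\max_{i\in I_t}\big(\langle c_t^{i,w},(x;u)\rangle+d_t^{i,w}\big)+\delta_{P_t^w}(x,u),$$ where $I_t$ is a finite set, $c_t^{i,w}\in\mathbb X\times\mathbb U$, $d_t^{i,w}\in\mathbb R$, $P_t^w\subset\mathbb X\times\mathbb U$ is a convex polyhedron, and $\delta_A$ is $0$ on $A$ and $+\infty$ elsewhere. The final cost is $\psi(x)=\max_{i\in I_T}(\langle c_T^i,x\rangle+d_T^i)+\delta_{X_T}(x)$ with $I_T$ finite and $X_T$ a nonempty convex polytope. $\mathrm{dom}\,g=\{g<+\infty\}$. For $t<T$, $X_t=\bigcap_{w\in\mathrm{supp}(\mathbf W_{t+1})}\pi_{\mathbb X}(\mathrm{dom}\,c_t^w)$ with $\pi_{\mathbb X}(x,u)=x$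 (and $X_T=\mathrm{dom}\,\psi$), and $\mathcal U_t^w(x)=\{u\in\mathbb U:c_t^w(x,u)<+\infty\text{ and }f_t^w(x,u)\in X_{t+1}\}$. For such problems $f_t^w$ and $c_t^w$ are Lipschitz on $\mathrm{dom}\,c_t^w$ and $\mathcal U_t^w$ is Lipschitz on $X_t$ for the Hausdorff distance. For $\phi:\mathbb X\to\overline{\mathbb R}$: $\mathcal B_t^w(\phi)(x)=\min_{u\in\mathbb U}\big(c_t^w(x,u)+\phi(f_t^w(x,u))\big)$ and $\mathfrak B_t(\phi)(x)=\sum_{w\in\mathrm{supp}(\mathbf W_{t+1})}p_w\,\mathcal B_t^w(\phi)(x)$. Value functions: $V_T=\psi$, $V_t=\mathfrak B_t(V_{t+1})$ for $t<T$. The constants $L_{V_t}>0$ depend only on the problem data and are obtained by backward recursion: $L_{V_T}$ is a Lipschitz constant of $\psi$ on $X_T$, and $L_{V_t}$ is the constant, depending only on the data and on $L_{V_{t+1}}$, given by the fact that $\mathfrak B_t$ sends functions that are $L_{V_{t+1}}$-Lipschitz on $X_{t+1}$ to functions that are $L_{V_t}$-Lipschitz on $X_t$; in particular $V_t$ is $L_{V_t}$-Lipschitz on $X_t$. Basic functions: $\underline{\mathbf F}_t^{\mathrm{SDDP}}=\{\langle a,\cdot\rangle+b+\delta_{X_t}:(a,b)\in\mathbb X\times\mathbb R,\ \|a\|\le L_{V_t}\}$. The mapping at $t=T$: for $x\in X_T$, $\underline S_T^{\mathrm{SDDP}}(x)=\langle a_x,\cdot-x\rangle+b_x+\delta_{X_T}$,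 where $a_x$ is a subgradient of the convex polyhedral function $\psi$ at $x$ and $b_x=\psi(x)$. The mapping for $t<T$: given a set $F\subset\underline{\mathbf F}_{t+1}^{\mathrm{SDDP}}$ and $x\in X_t$, for each $w\in\mathrm{supp}(\mathbf W_{t+1})$ compute $b^w=\mathcal B_t^w(\underline{\mathcal V}_F)(x)$ and a subgradient $a^w$ of $\mathcal B_t^w(\underline{\mathcal V}_F)$ at $x$; then $\underline S_t^{\mathrm{SDDP}}(F,x)=\langle a,\cdot-x\rangle+b+\delta_{X_t}$ with $a=\sum_wp_wa^w$ and $b=\sum_wp_wb^w$.
   Formalization: F is taken nonempty with V_F finite somewhere on X_{t+1} (else no real intercept); any choice of subgradients gives tightness and validity, with values in F_t at interior points of X_t; on the boundary membership in F_t holds for a suitable choice of subgradients, as it fails for arbitrary ones. *)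

(* Defs.v *)
From HB Require Import structures.
From mathcomp Require Import all_boot all_order all_algebra.
From mathcomp Require Import all_classical all_reals all_analysis.

Set Implicit Arguments.
Unset Strict Implicit.
Unset Printing Implicit Defensive.

Import Order.TTheory GRing.Theory Num.Theory.
Import numFieldNormedType.Exports.

Local Open Scope classical_set_scope.
Local Open Scope ring_scope.

Definition dotv (R : realType) (n : nat) (a x : 'cV[R]_n) : R :=
  \sum_(i < n) a i 0 * x i 0.

(* The norm [`|x|] of the library on matrices is the sup norm. *)
Definition enorm (R : realType) (n : nat) (x : 'cV[R]_n) : R :=
  Num.sqrt (dotv x x).

Definition delta (R : realType) (V : Type) (A : set V) (x : V) : \bar R :=
  if `[< A x >] then 0%E else +oo%E.

Definition edom (R : realType) (V : Type) (g : V -> \bar R) : set V :=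
  [set x | (g x < +oo)%E].

Definition polyhedron (R : realType) (q : nat) (A : set 'cV[R]_q) : Prop :=
  exists (k : nat) (G : 'M[R]_(k, q)) (h : 'cV[R]_k),
    A = [set z | forall i, (G *m z) i 0 <= h i 0].

Definition polytope (R : realType) (q : nat) (A : set 'cV[R]_q) : Prop :=
  polyhedron A /\ exists M : R, forall z, A z -> enorm z <= M.

Definition lipschitz_on (R : realType) (n : nat) (L : R) (A : set 'cV[R]_n)
    (g : 'cV[R]_n -> \bar R) : Prop :=
  (forall x, A x -> g x \is a fin_num) /\
  (forall x y, A x -> A y -> (`|g x - g y| <= (L * enorm (x - y))%:E)%E).

Definition subgradient (R : realType) (n : nat) (g : 'cV[R]_n -> \bar R)
    (x a : 'cV[R]_n) : Prop :=
  g x \is a fin_num /\ forall y, (g x + (dotv a (y - x))%:E <= g y)%E.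

Definition noise_supp d (Omega : measurableType d) (R : realType)
    (Pr : probability Omega R) dW (TW : measurableType dW)
    (Z : {RV Pr >-> TW}) : set TW :=
  [set w | (0 < Pr (Z @^-1` [set w]))%E].

Definition noise_prob d (Omega : measurableType d) (R : realType)
    (Pr : probability Omega R) dW (TW : measurableType dW)
    (Z : {RV Pr >-> TW}) (w : TW) : R :=
  fine (Pr (Z @^-1` [set w])).

Definition finitely_supported d (Omega : measurableType d) (R : realType)
    (Pr : probability Omega R) dW (TW : measurableType dW)
    (Z : {RV Pr >-> TW}) : Prop :=
  finite_set (noise_supp Z) /\ Pr (Z @^-1` noise_supp Z) = 1%E.

Definition independent_noises d (Omega : measurableType d) (R : realType)
    (Pr : probability Omega R) dW (TW : measurableType dW) (T : nat)
    (W : nat -> {RV Pr >-> TW}) : Prop :=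
  forall (J : {set 'I_T}) (B : 'I_T -> set TW),
    (forall j, measurable (B j)) ->
    Pr (\bigcap_(j in [set` J]) (W j.+1 @^-1` B j)) =
    (\prod_(j in J) Pr (W j.+1 @^-1` B j))%E.

(* Only [lp_W t] for 1 <= t <= lp_T is meaningful, and, for the stage data,
   only the stages t < lp_T and the values w in the support of [lp_W t.+1]. *)
Record lp_problem (R : realType) d (Omega : measurableType d)
    (Pr : probability Omega R) dW (TW : measurableType dW) (n m : nat) :=
  LPProblem {
    lp_T : nat;
    lp_W : nat -> {RV Pr >-> TW};
    lp_A : nat -> TW -> 'M[R]_(n, n);
    lp_B : nat -> TW -> 'M[R]_(n, m);
    lp_I : nat -> finType;
    lp_c : forall t, lp_I t -> TW -> 'cV[R]_(n + m);
    lp_d : forall t, lp_I t -> TW -> R;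
    lp_P : nat -> TW -> set 'cV[R]_(n + m);
    lp_cT : lp_I lp_T -> 'cV[R]_n;
    lp_dT : lp_I lp_T -> R;
    lp_XT : set 'cV[R]_n
  }.

Section LinearPolyhedral.
Context (R : realType) d (Omega : measurableType d) (Pr : probability Omega R)
  dW (TW : measurableType dW) (n m : nat) (Q : lp_problem Pr TW n m).

Local Notation T := (lp_T Q).
Implicit Types (t : nat) (w : TW) (x y : 'cV[R]_n) (u : 'cV[R]_m)
  (phi g : 'cV[R]_n -> \bar R) (F : set ('cV[R]_n -> \bar R)) (L : nat -> R).

(* [lp_supp t] and [lp_p t w] refer to the noise of index t + 1. *)
Definition lp_supp t : set TW := noise_supp (lp_W Q t.+1).
Definition lp_p t w : R := noise_prob (lp_W Q t.+1) w.

Definition dynamics t w x u : 'cV[R]_n := lp_A Q t w *m x + lp_B Q t w *m u.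

Definition cost t w x u : \bar R :=
  (\big[maxe/-oo]_(i : lp_I Q t)
      (dotv (lp_c i w) (col_mx x u) + lp_d i w)%:E
   + delta R (lp_P Q t w) (col_mx x u))%E.

Definition final_cost x : \bar R :=
  (\big[maxe/-oo]_(i : lp_I Q T) (dotv (lp_cT i) x + lp_dT i)%:E
   + delta R (lp_XT Q) x)%E.

Definition linear_polyhedral : Prop :=
  [/\ (1 <= T)%N,
      (forall t, (t <= T)%N -> (0 < #|lp_I Q t|)%N),
      (forall t w, (t < T)%N -> lp_supp t w -> polyhedron (lp_P Q t w)),
      lp_XT Q !=set0 & polytope (lp_XT Q)].

Definition stateX t : set 'cV[R]_n :=
  if (t < T)%N then
    [set x | forall w, lp_supp t w -> exists u, (cost t w x u < +oo)%E]
  else edom final_cost.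

Definition controlU t w x : set 'cV[R]_m :=
  [set u | (cost t w x u < +oo)%E /\ stateX t.+1 (dynamics t w x u)].

(* [%dE] is the addition of the extended reals with
   (+oo) + (-oo) = +oo, so that an infeasible pair (x, u) always costs +oo. *)
Definition bellman_w t w phi x : \bar R :=
  ereal_inf (range (fun u => (cost t w x u + phi (dynamics t w x u))%dE)).

Definition bellman t phi x : \bar R :=
  (\sum_(w \in lp_supp t) ((lp_p t w)%:E * bellman_w t w phi x)%E)%dE.

Fixpoint value_rev (k : nat) : 'cV[R]_n -> \bar R :=
  if k is k'.+1 then bellman (T - k'.+1)%N (value_rev k') else final_cost.

Definition value t : 'cV[R]_n -> \bar R := value_rev (T - t)%N.

(* The constant of stage t may be any positive real for which the Bellman
   operator propagates Lipschitz continuity; the functions it is applied to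
   live on [stateX t.+1], i.e. equal +oo elsewhere. *)
Definition lipschitz_constants L : Prop :=
  [/\ (forall t, (t <= T)%N -> 0 < L t),
      lipschitz_on (L T) (stateX T) final_cost
    & forall t phi, (t < T)%N ->
        (forall x, ~ stateX t.+1 x -> phi x = +oo%E) ->
        lipschitz_on (L t.+1) (stateX t.+1) phi ->
        lipschitz_on (L t) (stateX t) (bellman t phi)].

Definition basic L t : set ('cV[R]_n -> \bar R) :=
  [set g | exists (a : 'cV[R]_n) (b : R), enorm a <= L t /\
     g = fun y => ((dotv a y + b)%:E + delta R (stateX t) y)%E].

Definition sup_of F : 'cV[R]_n -> \bar R :=
  fun y => ereal_sup [set phi y | phi in F].

Definition cut t (a x : 'cV[R]_n) (b : R) : 'cV[R]_n -> \bar R :=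
  fun y => ((dotv a (y - x) + b)%:E + delta R (stateX t) y)%E.

Definition sddp_cutT x g : Prop :=
  exists (a : 'cV[R]_n) (b : R),
    [/\ subgradient final_cost x a, final_cost x = b%:E & g = cut T a x b].

Definition sddp_cut t F x g : Prop :=
  exists (a : TW -> 'cV[R]_n) (b : TW -> R),
    (forall w, lp_supp t w ->
       bellman_w t w (sup_of F) x = (b w)%:E /\
       subgradient (bellman_w t w (sup_of F)) x (a w)) /\
    g = cut t (\sum_(w \in lp_supp t) lp_p t w *: a w) x
              (\sum_(w \in lp_supp t) lp_p t w * b w).

(* Sets of basic functions whose supremum is finite somewhere on the next state
   set. For the others (the empty set, or an unbounded set of functions) the
   supremum is identically -oo or +oo and the cut has no real intercept. *)
Definition admissible L t F : Prop :=
  [/\ F `<=` basic L t.+1, F !=set0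
    & exists2 y, stateX t.+1 y & (sup_of F y < +oo)%E].

(* A mapping built with some choice of the subgradients. *)
Definition sddp_mapT (S : 'cV[R]_n -> 'cV[R]_n -> \bar R) : Prop :=
  forall x, stateX T x -> sddp_cutT x (S x).

Definition sddp_map L t
    (S : set ('cV[R]_n -> \bar R) -> 'cV[R]_n -> 'cV[R]_n -> \bar R) : Prop :=
  forall F x, admissible L t F -> stateX t x -> sddp_cut t F x (S F x).

Definition tight_validT (S : 'cV[R]_n -> 'cV[R]_n -> \bar R) : Prop :=
  forall x, stateX T x ->
    S x x = value T x /\ forall y, (S x y <= value T y)%E.

Definition tight_valid L t
    (S : set ('cV[R]_n -> \bar R) -> 'cV[R]_n -> 'cV[R]_n -> \bar R) : Prop :=
  forall F x, admissible L t F -> stateX t x ->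
    S F x x = bellman t (sup_of F) x /\
    forall y, (S F x y <= bellman t (sup_of F) y)%E.

Definition selectionT L (S : 'cV[R]_n -> 'cV[R]_n -> \bar R) : Prop :=
  (forall x, stateX T x -> basic L T (S x)) /\ tight_validT S.

Definition selection L t
    (S : set ('cV[R]_n -> \bar R) -> 'cV[R]_n -> 'cV[R]_n -> \bar R) : Prop :=
  (forall F x, admissible L t F -> stateX t x -> basic L t (S F x)) /\
  tight_valid L t S.

End LinearPolyhedral.

(* Main.v *)
Require Import Defs.
From HB Require Import structures.
From mathcomp Require Import all_boot all_order all_algebra.
From mathcomp Require Import all_classical all_reals all_analysis.
From mathcomp Require Import finmap ring lra.

Set Implicit Arguments.
Unset Strict Implicit.
Unset Printing Implicit Defensive.

Import Order.TTheory GRing.Theory Num.Theory.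
Import numFieldNormedType.Exports.

Local Open Scope classical_set_scope.
Local Open Scope ring_scope.

(** The delicate point is to choose, for every noise value [w], a subgradient
    [a w] of [bellman_w w (sup_of F)] at [x] so that the average of the [a w] has
    norm at most [L t], although [x] may lie on the boundary of [stateX t] and the
    functions [bellman_w w (sup_of F)] have domains larger than [stateX t].

    All the [a w] are obtained at once as a linear minorant (Hahn-Banach in finite
    dimension) of an infimal convolution on the product over [w] of copies of the
    state space. This needs a calmness estimate: perturbing the state separately
    for each [w] decreases the optimal cost at most linearly. The estimate follows
    from the Lipschitz continuity of the average on [stateX t] together with
    Hoffman's error bound for the polyhedra involved, which is derived from a
    quantitative Fourier-Motzkin elimination. *)

(** * Inner product and Euclidean norm on column vectors *)

Section Euclidean.
Context (R : realType).
Implicit Types (q : nat).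

Lemma dotvC q (a x : 'cV[R]_q) : dotv a x = dotv x a.
Proof. by apply: eq_bigr => i _; rewrite mulrC. Qed.

Lemma dotvDr q (a x y : 'cV[R]_q) : dotv a (x + y) = dotv a x + dotv a y.
Proof. by rewrite /dotv -big_split; apply: eq_bigr => i _ /=; rewrite mxE mulrDr. Qed.

Lemma dotvZr q (a x : 'cV[R]_q) k : dotv a (k *: x) = k * dotv a x.
Proof. by rewrite /dotv mulr_sumr; apply: eq_bigr => i _; rewrite mxE mulrCA. Qed.

Lemma dotvDl q (a b x : 'cV[R]_q) : dotv (a + b) x = dotv a x + dotv b x.
Proof. by rewrite dotvC dotvDr dotvC (dotvC x b). Qed.

Lemma dotvZl q (a x : 'cV[R]_q) k : dotv (k *: a) x = k * dotv a x.
Proof. by rewrite dotvC dotvZr dotvC. Qed.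

Lemma dotvNr q (a x : 'cV[R]_q) : dotv a (- x) = - dotv a x.
Proof. by rewrite -scaleN1r dotvZr mulN1r. Qed.

Lemma dotvBr q (a x y : 'cV[R]_q) : dotv a (x - y) = dotv a x - dotv a y.
Proof. by rewrite dotvDr dotvNr. Qed.

Lemma dotv0r q (a : 'cV[R]_q) : dotv a 0 = 0.
Proof. by rewrite -(scale0r 0) dotvZr mul0r. Qed.

Lemma dotv0l q (a : 'cV[R]_q) : dotv 0 a = 0.
Proof. by rewrite dotvC dotv0r. Qed.

Lemma dotv_suml q (I : Type) (s : seq I) (a : I -> 'cV[R]_q) x :
  dotv (\sum_(i <- s) a i) x = \sum_(i <- s) dotv (a i) x.
Proof. by elim/big_rec2: _ => [|i y z _ <-]; rewrite ?dotv0l ?dotvDl. Qed.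

Lemma dotv_delta q (a : 'cV[R]_q) i k : dotv a (k *: delta_mx i 0) = k * a i 0.
Proof.
rewrite dotvZr /dotv (bigD1 i) //= mxE !eqxx mulr1 big1 ?addr0// => j ji.
by rewrite mxE (negbTE ji) mulr0.
Qed.

Lemma dotv_col_mx q r (a : 'cV[R]_(q + r)) y u :
  dotv a (col_mx y u) = dotv (usubmx a) y + dotv (dsubmx a) u.
Proof.
rewrite /dotv big_split_ord /=; congr (_ + _); apply: eq_bigr => i _.
  by rewrite col_mxEu !mxE.
by rewrite col_mxEd !mxE.
Qed.

Lemma dotv_mulmx q r (M : 'M[R]_(q, r)) a z : dotv (M^T *m a) z = dotv a (M *m z).
Proof.
rewrite /dotv; under eq_bigr do rewrite mxE mulr_suml.
rewrite exchange_big; apply: eq_bigr => i _ /=.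
by rewrite mxE mulr_sumr; apply: eq_bigr => j _; rewrite mxE; ring.
Qed.

Lemma dotvv_ge0 q (x : 'cV[R]_q) : 0 <= dotv x x.
Proof. by apply: sumr_ge0 => i _; rewrite -expr2 sqr_ge0. Qed.

Lemma enorm_ge0 q (x : 'cV[R]_q) : 0 <= enorm x.
Proof. exact: sqrtr_ge0. Qed.

Lemma sqr_enorm q (x : 'cV[R]_q) : enorm x ^+ 2 = dotv x x.
Proof. by rewrite sqr_sqrtr ?dotvv_ge0. Qed.

Lemma enorm0 q : enorm (0 : 'cV[R]_q) = 0.
Proof. by rewrite /enorm dotv0r sqrtr0. Qed.

Lemma enormZ q k (x : 'cV[R]_q) : enorm (k *: x) = `|k| * enorm x.
Proof.
by rewrite /enorm dotvZl dotvZr mulrA -expr2 sqrtrM ?sqr_ge0// sqrtr_sqr.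
Qed.

Lemma enormN q (x : 'cV[R]_q) : enorm (- x) = enorm x.
Proof. by rewrite -scaleN1r enormZ normrN1 mul1r. Qed.

Lemma enormB q (x y : 'cV[R]_q) : enorm (x - y) = enorm (y - x).
Proof. by rewrite -enormN opprB. Qed.

Lemma enorm_eq0 q (x : 'cV[R]_q) : enorm x = 0 -> x = 0.
Proof.
move=> /eqP; rewrite -sqrf_eq0 sqr_enorm psumr_eq0 => [/allP x0|i _]; last first.
  by rewrite -expr2 sqr_ge0.
apply/colP => i; have := x0 i; rewrite mem_index_enum => /(_ isT) /=.
by rewrite mulf_eq0 orbb mxE => /eqP.
Qed.

Lemma cauchy_schwarz q (a x : 'cV[R]_q) : dotv a x <= enorm a * enorm x.
Proof.
have [/eqP/enorm_eq0 ->|x0] := boolP (enorm x == 0).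
  by rewrite dotv0r enorm0 mulr0.
have [/eqP/enorm_eq0 ->|a0] := boolP (enorm a == 0).
  by rewrite dotv0l enorm0 mul0r.
have xp : 0 < enorm x by rewrite lt_def x0 enorm_ge0.
have ap : 0 < enorm a by rewrite lt_def a0 enorm_ge0.
(* This square expands to [2 * A * X * (A * X - D)], whose factor [2 * A * X] is positive. *)
have := dotvv_ge0 (enorm x *: a - enorm a *: x).
rewrite dotvBr !dotvZr dotvC dotvBr !dotvZr -(dotvC x).
rewrite (dotvC (_ - _)) dotvBr !dotvZr -!sqr_enorm (dotvC x a).
set A := enorm a; set X := enorm x; set D := dotv a x.
rewrite (_ : _ - _ = 2 * A * X * (A * X - D)); last by ring.
by rewrite pmulr_rge0 ?subr_ge0// !mulr_gt0.
Qed.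

Lemma normr_dotv q (a x : 'cV[R]_q) : `|dotv a x| <= enorm a * enorm x.
Proof.
rewrite ler_norml cauchy_schwarz andbT lerNl -dotvNr -(enormN x).
exact: cauchy_schwarz.
Qed.

Lemma enormD q (x y : 'cV[R]_q) : enorm (x + y) <= enorm x + enorm y.
Proof.
rewrite -ler_sqr ?nnegrE ?enorm_ge0 ?addr_ge0 ?enorm_ge0//.
rewrite sqr_enorm dotvDr !dotvDl (dotvC y) sqrrD !sqr_enorm.
by have := cauchy_schwarz x y; lra.
Qed.

Lemma enorm_triangle q (x y z : 'cV[R]_q) :
  enorm (x - z) <= enorm (x - y) + enorm (y - z).
Proof. by rewrite (_ : x - z = (x - y) + (y - z)) ?enormD// subrKA. Qed.

(** Converts the coordinatewise bounds produced by elimination into Euclidean ones. The factor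
    [q%:R] is crude, but only the existence of a constant matters later. *)
Lemma enorm_le_coord q (x : 'cV[R]_q) c :
  (forall i, `|x i 0| <= c) -> enorm x <= q%:R * c.
Proof.
move=> xc; have [->|/(cV0Pn)[i xi0]] := eqVneq x 0.
  rewrite enorm0; case: q x xc => [|q] x xc; first by rewrite mul0r.
  by rewrite mulr_ge0// (le_trans _ (xc ord0)).
have c0 : 0 <= c by rewrite (le_trans _ (xc i)).
have q1 : (1 : R) <= q%:R by rewrite ler1n (leq_ltn_trans _ (ltn_ord i)).
rewrite -ler_sqr ?nnegrE ?enorm_ge0 ?mulr_ge0// sqr_enorm.
apply: (@le_trans _ _ (\sum_(i < q) c ^+ 2)).
  by apply: ler_sum => j _; rewrite -expr2 -real_normK ?num_real// ler_sqr ?nnegrE.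
rewrite sumr_const card_ord -[leLHS]mulr_natl exprMn ler_wpM2r ?sqr_ge0//.
by rewrite expr2 ler_peMl.
Qed.

Lemma enorm_col_mx q r (y : 'cV[R]_q) (u : 'cV[R]_r) :
  enorm (col_mx y u) <= enorm y + enorm u.
Proof.
rewrite (_ : col_mx y u = col_mx y 0 + col_mx 0 u); last first.
  by rewrite add_col_mx addr0 add0r.
apply: (le_trans (enormD _ _)).
rewrite /enorm !dotv_col_mx !col_mxKu !col_mxKd.
by rewrite !dotv0r add0r addr0.
Qed.

Lemma enorm_mulmx q r (M : 'M[R]_(q, r)) :
  exists2 K, 0 <= K & forall z, enorm (M *m z) <= K * enorm z.
Proof.
pose k : R := \sum_i enorm (row i M)^T.
have k0 : 0 <= k by apply: sumr_ge0 => i _; exact: enorm_ge0.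
exists (q%:R * k) => [|z]; first by rewrite mulr_ge0.
rewrite -mulrA; apply: enorm_le_coord => i.
have -> : (M *m z) i 0 = dotv (row i M)^T z.
  by rewrite mxE; apply: eq_bigr => j _; rewrite !mxE.
apply: (le_trans (normr_dotv _ _)); rewrite ler_wpM2r ?enorm_ge0//.
by rewrite /k (bigD1 i) //= lerDl sumr_ge0// => j _; exact: enorm_ge0.
Qed.

End Euclidean.

(** * Linear inequality systems: Fourier-Motzkin elimination and error bounds *)

Section LinearSystems.
Context (R : realType).

(** A system is a list of half-spaces (normal vector, right-hand side), so that elimination can
    filter and pair its members. *)
Definition sat q (C : seq ('cV[R]_q * R)) (x : 'cV[R]_q) : Prop :=
  forall c, c \in C -> dotv c.1 x <= c.2.

Definition nearsat q (v : R) (C : seq ('cV[R]_q * R)) (x : 'cV[R]_q) : Prop :=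
  forall c, c \in C -> dotv c.1 x <= c.2 + v.

Lemma sat_nearsat q (C : seq ('cV[R]_q * R)) x : sat C x -> nearsat 0 C x.
Proof. by move=> Cx c cC; rewrite addr0; exact: Cx. Qed.

Lemma nearsat_sat q (C : seq ('cV[R]_q * R)) x : nearsat 0 C x -> sat C x.
Proof. by move=> Cx c /Cx; rewrite addr0. Qed.

Lemma nearsatS q (C : seq ('cV[R]_q * R)) v v' x :
  v <= v' -> nearsat v C x -> nearsat v' C x.
Proof. by move=> vv' Cx c /Cx/le_trans; apply; rewrite lerD2l. Qed.

Lemma sat_cat q (C C' : seq ('cV[R]_q * R)) x :
  sat (C ++ C') x <-> sat C x /\ sat C' x.
Proof.
split=> [CC|[Cx C'x] c]; first by split=> c cC; apply: CC; rewrite mem_cat cC ?orbT.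
by rewrite mem_cat => /orP[/Cx|/C'x].
Qed.

Lemma sat_flatten q (I : finType) (C : I -> seq ('cV[R]_q * R)) x :
  sat (flatten [seq C i | i <- enum I]) x <-> forall i, sat (C i) x.
Proof.
split=> [Cx i c cC|Cx c /flatten_mapP[i _]]; last exact: Cx.
by apply: Cx; apply/flatten_mapP; exists i; rewrite ?mem_enum.
Qed.

(** Moving from [x] to [y] changes the left side of [c] by at most [enorm c.1 * enorm (y - x)]; the
    sum of all these norms serves every constraint. *)
Lemma nearsat_lipschitz q (C : seq ('cV[R]_q * R)) :
  exists2 M, 0 <= M & forall x y v, nearsat v C x ->
    nearsat (v + M * enorm (y - x)) C y.
Proof.
exists (\sum_(c <- C) enorm c.1) => [|x y v Cx c cC].
  by apply: sumr_ge0 => c _; exact: enorm_ge0.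
rewrite -{1}(subrKC x y) dotvDr addrA lerD ?Cx//.
apply: (le_trans (cauchy_schwarz _ _)); rewrite ler_wpM2r ?enorm_ge0//.
by rewrite (big_rem c) //= lerDl sumr_ge0// => ? _; exact: enorm_ge0.
Qed.

(** The floor [a] covers the empty list, and the last clause allows a case analysis on where the
    maximum is attained. *)
Lemma seq_max_exists (I : eqType) (s : seq I) (f : I -> R) a :
  exists b, [/\ a <= b, forall i, i \in s -> f i <= b
    & b = a \/ exists2 i, i \in s & b = f i].
Proof.
elim: s => [|i s [b [ab sb bE]]]; first by exists a; split => //; left.
exists (Num.max b (f i)); split; first by rewrite le_max ab.
  move=> j; rewrite inE le_max => /orP[/eqP ->|/sb -> //].
  by rewrite lexx orbT.
have [fb|bf] := leP (f i) b; last by right; exists i; rewrite ?inE ?eqxx.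
case: bE => [->|[j js ->]]; [by left|right; exists j => //].
by rewrite inE js orbT.
Qed.

(** One Fourier-Motzkin step. The last clause makes it quantitative: the shift of coordinate [i]
    that restores [C] is proportional to the violation [v]. The clause on [j] keeps eliminated
    coordinates eliminated when the step is iterated. *)
Lemma eliminate_coord q (i : 'I_q) (C : seq ('cV[R]_q * R)) :
  exists (C1 : seq ('cV[R]_q * R)) (k : R),
  [/\ 0 <= k,
      forall c, c \in C1 -> c.1 i 0 = 0,
      forall j, (forall c, c \in C -> c.1 j 0 = 0) ->
        forall c, c \in C1 -> c.1 j 0 = 0,
      forall x v, 0 <= v -> nearsat v C x -> nearsat (k * v) C1 x
    & forall x v, 0 <= v -> sat C1 x -> nearsat v C x ->
        exists2 s, `|s| <= k * v & sat C (x + s *: delta_mx i 0)].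
Proof.
(* Divided by its [i]-th coefficient, a constraint bounds coordinate [i] above if the coefficient is
   positive and below if it is negative; [comb c c'] says that the lower bound of [c'] does not
   exceed the upper bound of [c]. *)
pose comb (c c' : 'cV[R]_q * R) : 'cV[R]_q * R :=
  ((c.1 i 0)^-1 *: c.1 - (c'.1 i 0)^-1 *: c'.1,
   (c.1 i 0)^-1 * c.2 - (c'.1 i 0)^-1 * c'.2).
pose C0 := [seq c : 'cV[R]_q * R <- C | c.1 i 0 == 0].
pose Cp := [seq c : 'cV[R]_q * R <- C | 0 < c.1 i 0].
pose Cn := [seq c : 'cV[R]_q * R <- C | c.1 i 0 < 0].
pose C1 := C0 ++ [seq comb c c' | c <- Cp, c' <- Cn].
pose K : R := \sum_(c <- C) `|(c : 'cV[R]_q * R).1 i 0|^-1.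
have K0 : 0 <= K by apply: sumr_ge0 => c _; rewrite invr_ge0.
have KC c : c \in C -> `|c.1 i 0|^-1 <= K.
  by move=> cC; rewrite /K (big_rem c) //= lerDl sumr_ge0// => ? _; rewrite invr_ge0.
have inC1 c : c \in C1 -> (c \in C /\ c.1 i 0 = 0) \/ exists c1 c2,
    [/\ c1 \in C, c2 \in C, 0 < c1.1 i 0, c2.1 i 0 < 0 & c = comb c1 c2].
  rewrite mem_cat mem_filter => /orP[/andP[/eqP ? ?]|]; first by left.
  move=> /allpairsP[[c1 c2] /= [+ + ->]]; rewrite !mem_filter.
  by move=> /andP[? ?] /andP[? ?]; right; exists c1, c2.
have combC1 c1 c2 : c1 \in C -> c2 \in C -> 0 < c1.1 i 0 -> c2.1 i 0 < 0 ->
    comb c1 c2 \in C1.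
  move=> h1 h2 h3 h4; rewrite mem_cat; apply/orP; right.
  by apply/allpairsP; exists (c1, c2); rewrite !mem_filter h1 h2 h3 h4.
have dcomb c1 c2 x : dotv (comb c1 c2).1 x =
    (c1.1 i 0)^-1 * dotv c1.1 x - (c2.1 i 0)^-1 * dotv c2.1 x.
  by rewrite /= dotvDl dotvZl -scaleNr dotvZl mulNr.
(* A combined constraint inherits at most [K * v] from each parent, a kept one at most [v]. *)
exists C1, (2 * K + 1); split.
- by rewrite addr_ge0// mulr_ge0.
- move=> c /inC1[[]//|[c1 [c2 [_ _ p1 n2 ->]]]].
  by rewrite !mxE (mulVf (lt0r_neq0 p1)) (mulVf (ltr0_neq0 n2)) subrr.
- move=> j Cj c /inC1[[/Cj//]|[c1 [c2 [/Cj c1j /Cj c2j _ _ ->]]]].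
  by rewrite !mxE c1j c2j !mulr0 subrr.
- move=> x v v0 Cx c /inC1[[cC _]|[c1 [c2 [c1C c2C p1 n2 ->]]]].
    apply: (le_trans (Cx _ cC)); rewrite lerD2l ler_peMl// lerDr.
    by rewrite mulr_ge0.
  rewrite dcomb /=.
  have h1 : (c1.1 i 0)^-1 * dotv c1.1 x <= (c1.1 i 0)^-1 * (c1.2 + v).
    by apply: ler_wpM2l; [rewrite invr_ge0 ltW|exact: Cx].
  have h2 : (c2.1 i 0)^-1 * (c2.2 + v) <= (c2.1 i 0)^-1 * dotv c2.1 x.
    by apply: ler_wnM2l; [rewrite invr_le0 ltW|exact: Cx].
  have h3 : (c1.1 i 0)^-1 * v <= K * v.
    by rewrite ler_wpM2r// -[X in X^-1]gtr0_norm// KC.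
  have h4 : - (c2.1 i 0)^-1 * v <= K * v.
    by rewrite ler_wpM2r// -invrN -[X in X^-1]ltr0_norm// KC.
  by move: h1 h2 h3 h4; lra.
- move=> x v v0 C1x Cx.
  (* [lo c] is the shift of coordinate [i] that turns [c] into an equality. The shift [s] is the
     largest of the lower limits and of [- (K * v)]; it respects the upper limits because [C1]
     orders the limits and near-satisfaction keeps the upper ones above the floor. *)
  pose lo (c : 'cV[R]_q * R) := (c.1 i 0)^-1 * (c.2 - dotv c.1 x).
  have [s [sK sC sE]] := seq_max_exists Cn lo (- (K * v)).
  have up c : c \in C -> 0 < c.1 i 0 -> s <= lo c.
    move=> cC cp; case: sE => [->|[c' + ->]].
      rewrite lerNl; have := Cx _ cC; rewrite -lerBlDl => h.
      apply: (@le_trans _ _ ((c.1 i 0)^-1 * v)).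
        rewrite /lo -mulrN; apply: ler_wpM2l; first by rewrite invr_ge0 ltW.
        by rewrite opprB.
      by rewrite ler_wpM2r// -[X in X^-1]gtr0_norm// KC.
    rewrite mem_filter => /andP[c'n c'C].
    have := C1x _ (combC1 _ _ cC c'C cp c'n); rewrite dcomb /lo /=; lra.
  exists s.
    rewrite ler_norml; apply/andP; split.
      apply: le_trans sK; rewrite lerN2 ler_wpM2r//; lra.
    apply: (@le_trans _ _ (K * v)); last by rewrite ler_wpM2r//; lra.
    case: sE => [->|[c + ->]]; first by have := mulr_ge0 K0 v0; lra.
    rewrite mem_filter => /andP[cn cC].
    have := Cx _ cC => h.
    apply: (@le_trans _ _ (- (c.1 i 0)^-1 * v)).
      rewrite /lo mulNr -mulrN; apply: ler_wnM2l; [by rewrite invr_le0 ltW|lra].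
    by rewrite ler_wpM2r// -invrN -[X in X^-1]ltr0_norm// KC.
  move=> c cC; rewrite dotvDr dotv_delta.
  have [cn|cp|c0] := ltgtP (c.1 i 0) 0.
  + have := sC c; rewrite mem_filter cn cC => /(_ isT).
    by rewrite /lo mulrC ler_ndivrMr//; lra.
  + by have := up _ cC cp; rewrite /lo mulrC ler_pdivlMr//; lra.
  + rewrite c0 mulr0 addr0; apply: C1x.
    by rewrite mem_cat mem_filter c0 eqxx cC.
Qed.

(* Fourier-Motzkin elimination, keeping track of the distance to the solution
   set: this gives at once the projection theorem for polyhedra and Hoffman's
   error bound. *)
Lemma eliminate_coords q (E : seq 'I_q) (C : seq ('cV[R]_q * R)) :
  exists (C1 : seq ('cV[R]_q * R)) (k : R),
  [/\ 0 <= k,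
      forall c i, c \in C1 -> i \in E -> c.1 i 0 = 0,
      forall j, (forall c, c \in C -> c.1 j 0 = 0) ->
        forall c, c \in C1 -> c.1 j 0 = 0,
      forall x v, 0 <= v -> nearsat v C x -> nearsat (k * v) C1 x
    & forall x v, 0 <= v -> sat C1 x -> nearsat v C x ->
        exists y, [/\ sat C y, forall i, `|y i 0 - x i 0| <= k * v
          & forall i, i \notin E -> y i 0 = x i 0]].
Proof.
elim: E C => [|i E IH] C.
  exists C, 1; split=> // [x v _|x v v0 Cx _]; first by rewrite mul1r.
  by exists x; split=> // i; rewrite subrr normr0 mul1r.
have [C1 [k1 [k10 C1i C1j CC1 C1C]]] := eliminate_coord i C.
have [C2 [k2 [k20 C2E C2j C1C2 C2C1]]] := IH C1.
have [M M0 MC] := nearsat_lipschitz C.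
(* Restoring [C1] moves the point by at most [q%:R * (k2 * (k1 * v))], which adds at most [M] times
   that to the residual [v] of [C]; restoring [C] then shifts coordinate [i] by at most [k1] times
   the new residual. *)
pose k3 := k1 * (1 + M * (q%:R * (k2 * k1))).
have k30 : 0 <= k3 by rewrite !(mulr_ge0, addr_ge0).
exists C2, (k2 * k1 + k3); split.
- by rewrite addr_ge0// mulr_ge0.
- move=> c j cC2; rewrite inE => /orP[/eqP ->|]; last exact: C2E.
  exact: (C2j i).
- by move=> j Cj; apply: C2j; exact: C1j.
- move=> x v v0 Cx.
  apply: (@nearsatS _ _ (k2 * (k1 * v))).
    by rewrite mulrA ler_wpM2r// lerDl.
  by apply: C1C2; [rewrite mulr_ge0|exact: CC1].
- move=> x v v0 C2x Cx.
  have kv0 : 0 <= k1 * v by rewrite mulr_ge0.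
  have [y1 [C1y1 y1x y1E]] := C2C1 x _ kv0 C2x (CC1 _ _ v0 Cx).
  have ey1 : enorm (y1 - x) <= q%:R * (k2 * (k1 * v)).
    by apply: enorm_le_coord => j; rewrite !mxE.
  have v1 : 0 <= v + M * (q%:R * (k2 * (k1 * v))).
    by rewrite !(mulr_ge0, addr_ge0).
  have [|s sk Cs] := C1C y1 _ v1 C1y1.
    by apply: nearsatS (MC _ y1 _ Cx); rewrite lerD2l ler_wpM2l.
  have sk3 : `|s| <= k3 * v by apply: le_trans sk _; rewrite /k3; lra.
  exists (y1 + s *: delta_mx i 0); split=> // j; rewrite !mxE.
    rewrite addrAC; apply: (le_trans (ler_normD _ _)).
    rewrite mulrDl -mulrA lerD// eqxx andbT normrM.
    apply: le_trans sk3; rewrite ler_piMr//.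
    by case: (j == i); rewrite ?normr1 ?normr0.
  by rewrite inE negb_or => /andP[/negbTE -> /y1E ->]; rewrite mulr0 addr0.
Qed.

(** Eliminating the last [m] coordinates leaves constraints on [y] alone, and the repaired point
    keeps the coordinates that were not eliminated, so that only [u] changes. *)
Lemma project_system n m (C : seq ('cV[R]_(n + m) * R)) :
  exists (C1 : seq ('cV[R]_n * R)) (k : R),
  [/\ 0 <= k,
      forall y u, sat C (col_mx y u) -> sat C1 y
    & forall y u v, 0 <= v -> sat C1 y -> nearsat v C (col_mx y u) ->
        exists2 u', sat C (col_mx y u') & enorm (u' - u) <= k * v].
Proof.
have [C2 [k [k0 C2E _ CC2 C2C]]] :=
  eliminate_coords [seq rshift n j | j <- enum 'I_m] C.
have d0 c : c \in C2 -> dsubmx c.1 = 0.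
  move=> cC2; apply/colP => j; rewrite !mxE; apply: C2E => //.
  by apply/mapP; exists j; rewrite ?mem_enum.
exists [seq (usubmx c.1, c.2) | c <- C2], (m%:R * k); split.
- by rewrite mulr_ge0.
- move=> y u Cyu _ /mapP[c cC2 ->] /=.
  have := CC2 _ 0 (lexx _) (sat_nearsat Cyu).
  by rewrite mulr0 => /nearsat_sat/(_ c cC2); rewrite dotv_col_mx d0// dotv0l addr0.
- move=> y u v v0 C1y Cyu.
  have C2yu : sat C2 (col_mx y u).
    move=> c cC2; rewrite dotv_col_mx d0// dotv0l addr0.
    by apply: (C1y (usubmx c.1, c.2)); apply/mapP; exists c.
  have [z [Cz zk zE]] := C2C _ _ v0 C2yu Cyu.
  have zy : usubmx z = y.
    apply/colP => i; rewrite mxE zE ?col_mxEu//.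
    by apply/mapP => -[j _ /eqP]; rewrite eq_lrshift.
  exists (dsubmx z); first by rewrite -{1}zy vsubmxK.
  rewrite -mulrA; apply: enorm_le_coord => j.
  by have := zk (rshift n j); rewrite col_mxEd !mxE.
Qed.

Lemma projection_system n m (C : seq ('cV[R]_(n + m) * R)) :
  exists C1 : seq ('cV[R]_n * R), forall y,
    (exists u, sat C (col_mx y u)) <-> sat C1 y.
Proof.
have [C1 [k [_ CC1 C1C]]] := project_system C; exists C1 => y.
split=> [[u]|C1y]; first exact: CC1.
(* The control 0 violates each constraint by at most the total violation [v], so the quantitative
   repair provides a feasible control. *)
pose v := \sum_(c <- C) `|dotv c.1 (col_mx y 0) - c.2|.
have [||u] := C1C y 0 v _ C1y.
- by apply: sumr_ge0 => c _.
- move=> c cC; rewrite -lerBlDl /v (big_rem c)//=.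
  by rewrite ler_wpDr ?ler_norm// sumr_ge0.
- by exists u.
Qed.

(** Once all coordinates are eliminated, the remaining constraints read [0 <= c.2]. Feasibility of
    the system makes them true, so every point can be repaired. *)
Lemma hoffman n (C : seq ('cV[R]_n * R)) : (exists x, sat C x) ->
  exists2 k, 0 <= k & forall z v, 0 <= v -> nearsat v C z ->
    exists2 z', sat C z' & enorm (z' - z) <= k * v.
Proof.
move=> [x Cx].
have [C2 [k [k0 C2E _ CC2 C2C]]] := eliminate_coords (enum 'I_n) C.
have C2z z : sat C2 z.
  move=> c cC2; have := CC2 _ 0 (lexx _) (sat_nearsat Cx).
  rewrite mulr0 => /nearsat_sat/(_ c cC2).
  have -> : c.1 = 0 by apply/colP => i; rewrite (C2E c)// ?mem_enum// mxE.
  by rewrite !dotv0l.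
exists (n%:R * k) => [|z v v0 Cz]; first by rewrite mulr_ge0.
have [z' [Cz' z'k _]] := C2C _ _ v0 (C2z z) Cz.
exists z' => //; rewrite -mulrA; apply: enorm_le_coord => j.
by have := z'k j; rewrite !mxE.
Qed.

Lemma polyhedron_system q (A : set 'cV[R]_q) : polyhedron A ->
  exists C : seq ('cV[R]_q * R), forall z, A z <-> sat C z.
Proof.
move=> [k [G [h ->]]].
have GE i z : (G *m z) i 0 = dotv (row i G)^T z.
  by rewrite mxE; apply: eq_bigr => j _; rewrite !mxE.
exists [seq ((row i G)^T, h i 0) | i <- enum 'I_k] => z; split => [Az|Cz i].
  by move=> _ /mapP[i _ ->] /=; rewrite -GE.
rewrite GE; apply: (Cz ((row i G)^T, h i 0)).
by apply/mapP; exists i; rewrite ?mem_enum.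
Qed.

Lemma preimage_system q r (M : 'M[R]_(q, r)) (C : seq ('cV[R]_q * R)) :
  exists C' : seq ('cV[R]_r * R), forall z, sat C (M *m z) <-> sat C' z.
Proof.
exists [seq (M^T *m c.1, c.2) | c <- C] => z; split => [Cz|Cz c cC].
  by move=> _ /mapP[c cC ->] /=; rewrite dotv_mulmx Cz.
rewrite -dotv_mulmx; apply: (Cz (M^T *m c.1, c.2)).
by apply/mapP; exists c.
Qed.

Lemma sat_convex q (C : seq ('cV[R]_q * R)) x y (s : R) : 0 <= s <= 1 ->
  sat C x -> sat C y -> sat C (s *: x + (1 - s) *: y).
Proof.
move=> /andP[s0 s1] Cx Cy c cC; rewrite dotvDr !dotvZr.
rewrite (_ : c.2 = s * c.2 + (1 - s) * c.2); last by ring.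
by rewrite lerD// ler_wpM2l ?subr_ge0// ?Cx ?Cy.
Qed.

End LinearSystems.

(** * Finite-dimensional Hahn-Banach theorem and joint subgradients *)

Section HahnBanach.
Context (R : realType).

(* Finite-dimensional Hahn-Banach theorem: the convex relation [S] plays the role
   of the epigraph of a finite convex function that is nonnegative at 0. The
   coordinates of the linear minorant are fixed one after the other, each time
   restricting [S] to the remaining coordinates. *)
Lemma hahn_banach_epigraph (J : finType) (S : (J -> R) -> R -> Prop) :
  (forall h0 s0 h1 s1 (c : R), 0 <= c <= 1 -> S h0 s0 -> S h1 s1 ->
     S (fun j => c * h0 j + (1 - c) * h1 j) (c * s0 + (1 - c) * s1)) ->
  (forall h, exists s, S h s) ->
  (forall s, S (fun=> 0) s -> 0 <= s) ->
  exists a : J -> R, forall h s, S h s -> \sum_j a j * h j <= s.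
Proof.
move=> Sconv Stot S0.
(* Generalized for induction on a list of coordinates outside which [h] vanishes. *)
suff [a aS] : exists a : J -> R, forall h s,
    (forall j, j \notin enum J -> h j = 0) -> S h s -> \sum_j a j * h j <= s.
  by exists a => h s; apply: aS => j; rewrite mem_enum.
elim: (enum J) S Sconv Stot S0 => [|j l IH] S Sconv Stot S0.
  exists (fun=> 0) => h s h0 Shs; rewrite big1 => [|j _]; last by rewrite mul0r.
  by apply: S0; rewrite (_ : (fun=> 0) = h)//; apply/funext => j; rewrite h0.
pose e (c : R) (k : J) : R := c * (k == j)%:R.
(* Zero is the convex combination of [e c] and [e (- d)] with weights proportional to [d] and [c],
   so [S0] bounds the combined height below. *)
have conv1 c d s s' : 0 < c -> 0 < d -> S (e c) s -> S (e (- d)) s' ->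
    - s' / d <= s / c.
  move=> c0 d0 Sc Sd; have cd : 0 < c + d by rewrite addr_gt0.
  have cd0 := lt0r_neq0 cd.
  have /S0 : S (fun=> 0) (d / (c + d) * s + (1 - d / (c + d)) * s').
    rewrite (_ : (fun=> 0) = fun k =>
        d / (c + d) * e c k + (1 - d / (c + d)) * e (- d) k); last first.
      by apply/funext => k; rewrite /e; case: (k == j) => /=; field.
    apply: Sconv => //; apply/andP; split; first by rewrite divr_ge0// ltW.
    by rewrite ler_pdivrMr// mul1r lerDr ltW.
  rewrite (_ : _ + _ = (d * s + c * s') / (c + d)); last by field.
  rewrite pmulr_lge0 ?invr_gt0// => h.
  rewrite ler_pdivlMr// mulrAC ler_pdivrMr//; lra.
(* Slopes along the negative half-axis: by [conv1] they lie below all slopes along the positive one,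
   so their supremum can serve as the [j]-th coefficient. *)
pose low : set R := [set r | exists d s, [/\ 0 < d, S (e (- d)) s & r = - s / d]].
have low_ub c s : 0 < c -> S (e c) s -> ubound low (s / c).
  by move=> c0 Sc _ [d [s' [d0 Sd ->]]]; exact: conv1.
have low0 : low !=set0.
  by have [s Ss] := Stot (e (- 1)); exists (- s / 1), 1, s.
have low_sup : has_sup low.
  by split=> //; have [s Ss] := Stot (e 1); exists (s / 1); exact: low_ub.
pose tau := sup low.
have tauP c s : S (e c) s -> c * tau <= s.
  move=> Sc; have [c0|c0|c0] := ltgtP c 0.
  - have : - s / (- c) <= tau.
      apply: sup_upper_bound => //; exists (- c), s.
      by rewrite opprK oppr_gt0.
    by rewrite ler_pdivrMr ?oppr_gt0//; lra.
  - have : tau <= s / c by apply: ge_sup => //; exact: low_ub.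
    by rewrite ler_pdivlMr// mulrC.
  - rewrite c0 mul0r; apply: S0; rewrite (_ : (fun=> 0) = e c)//.
    by apply/funext => k; rewrite /e c0 mul0r.
(* [S'] tilts [S] by the slope [tau] and projects coordinate [j] out; [tauP] keeps it nonnegative at
   zero. *)
pose S' (h : J -> R) (s : R) := exists c, S (fun k => h k + e c k) (s + c * tau).
have [h0 s0 h1 s1 th th01 [c0 Sc0] [c1 Sc1]|h|s [c Sc]|a aS'] := IH S'.
- exists (th * c0 + (1 - th) * c1).
  rewrite (_ : (fun k => _) = fun k =>
    th * (h0 k + e c0 k) + (1 - th) * (h1 k + e c1 k)); last first.
    by apply/funext => k; rewrite /e; ring.
  rewrite (_ : _ + _ * tau =
    th * (s0 + c0 * tau) + (1 - th) * (s1 + c1 * tau)); last by ring.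
  exact: Sconv.
- have [s Ss] := Stot h; exists s, 0.
  rewrite mul0r addr0 (_ : (fun k => _) = h)//.
  by apply/funext => k; rewrite /e mul0r addr0.
- have : S (e c) (s + c * tau).
    by rewrite (_ : e c = fun k => 0 + e c k)//; apply/funext => k; rewrite add0r.
  by move=> /tauP; rewrite lerDr.
exists (fun k => if k == j then tau else a k) => h s hl Shs.
pose h' k := if k == j then 0 else h k.
have hh' : h = fun k => h' k + e (h j) k.
  apply/funext => k; rewrite /h' /e; case: eqP => [->|_].
    by rewrite mulr1 add0r.
  by rewrite mulr0 addr0.
have /(aS' h') : forall k, k \notin l -> h' k = 0.
  move=> k kl; rewrite /h'; case: eqP => // /eqP kj.
  by apply: hl; rewrite inE negb_or kj.
move=> /(_ (s - h j * tau)) h's.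
have {}h's : \sum_k a k * h' k <= s - h j * tau.
  by apply: h's; exists (h j); rewrite -hh' subrK.
rewrite (bigD1 j)//= eqxx; rewrite (bigD1 j)//= {1}/h' eqxx mulr0 add0r in h's.
suff -> : \sum_(k | k != j) (if k == j then tau else a k) * h k =
  \sum_(k | k != j) a k * h' k by lra.
by apply: eq_bigr => k /negbTE kj; rewrite /h' kj.
Qed.

(* The sets [E i] are (strict) epigraphs of convex functions [f i] with
   [f i x = v i]. The calmness inequality makes the function
     h |-> inf { sum p (f i (y i) - v i) + L |z - x| + K sum |h i - (y i - z)| }
   finite, and a linear minorant of it yields all the subgradients at once. *)
Lemma joint_subgradient (I : finType) n (p v : I -> R)
    (E : I -> 'cV[R]_n -> R -> Prop) (x : 'cV[R]_n) (L K : R) :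
  0 <= L -> 0 <= K -> (forall i, 0 < p i) ->
  (forall i y0 r0 y1 r1 (c : R), 0 <= c <= 1 -> E i y0 r0 -> E i y1 r1 ->
     E i (c *: y0 + (1 - c) *: y1) (c * r0 + (1 - c) * r1)) ->
  (forall i (eps : R), 0 < eps -> E i x (v i + eps)) ->
  (forall z y r, (forall i, E i (y i) (r i)) ->
     0 <= \sum_i p i * (r i - v i) + L * enorm (z - x)
        + K * \sum_i enorm (y i - z)) ->
  exists a : I -> 'cV[R]_n,
    (forall i y r, E i y r -> v i + dotv (a i) (y - x) <= r) /\
    enorm (\sum_i p i *: a i) <= L.
Proof.
move=> L0 K0 p0 Econv Ex calm.
pose hc (h : I * 'I_n -> R) i : 'cV[R]_n := \col_j h (i, j).
pose val h z (y : I -> 'cV[R]_n) (r : I -> R) :=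
  \sum_i p i * (r i - v i) + L * enorm (z - x)
  + K * \sum_i enorm (hc h i - (y i - z)).
pose S h s := exists z y r, (forall i, E i (y i) (r i)) /\ val h z y r <= s.
have enorm_conv (c : R) (y0 y1 : 'cV[R]_n) : 0 <= c <= 1 ->
    enorm (c *: y0 + (1 - c) *: y1) <= c * enorm y0 + (1 - c) * enorm y1.
  move=> /andP[c0 c1]; apply: (le_trans (enormD _ _)).
  by rewrite !enormZ !ger0_norm ?subr_ge0.
have [||s [z [y [r [Eyr]]]]|a aS] := @hahn_banach_epigraph _ S.
- move=> h0 s0 h1 s1 c c01 [z0 [y0 [r0 [E0 le0]]]] [z1 [y1 [r1 [E1 le1]]]].
  have /andP[c0 c1] := c01.
  exists (c *: z0 + (1 - c) *: z1), (fun i => c *: y0 i + (1 - c) *: y1 i),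
    (fun i => c * r0 i + (1 - c) * r1 i); split=> [i|]; first exact: Econv.
  apply: (@le_trans _ _ (c * val h0 z0 y0 r0 + (1 - c) * val h1 z1 y1 r1));
    last by rewrite lerD// ler_wpM2l ?subr_ge0.
  rewrite /val.
  have -> : \sum_i p i * (c * r0 i + (1 - c) * r1 i - v i) =
      c * (\sum_i p i * (r0 i - v i)) + (1 - c) * (\sum_i p i * (r1 i - v i)).
    by rewrite !mulr_sumr -big_split; apply: eq_bigr => i _ /=; ring.
  have h2 : L * enorm (c *: z0 + (1 - c) *: z1 - x) <=
      L * (c * enorm (z0 - x) + (1 - c) * enorm (z1 - x)).
    have -> : c *: z0 + (1 - c) *: z1 - x = c *: (z0 - x) + (1 - c) *: (z1 - x).
      by apply/colP => j; rewrite !mxE; ring.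
    by rewrite ler_wpM2l ?enorm_conv.
  have h3 : K * \sum_i enorm (hc (fun j => c * h0 j + (1 - c) * h1 j) i -
        (c *: y0 i + (1 - c) *: y1 i - (c *: z0 + (1 - c) *: z1))) <=
      K * (c * (\sum_i enorm (hc h0 i - (y0 i - z0))) +
           (1 - c) * (\sum_i enorm (hc h1 i - (y1 i - z1)))).
    rewrite ler_wpM2l// !mulr_sumr -big_split; apply: ler_sum => i _ /=.
    rewrite [X in enorm X](_ : _ = c *: (hc h0 i - (y0 i - z0)) +
        (1 - c) *: (hc h1 i - (y1 i - z1))); first exact: enorm_conv.
    by apply/colP => j; rewrite !mxE; ring.
  by move: h2 h3; lra.
- move=> h; exists (val h x (fun=> x) (fun i => v i + 1)), x, (fun=> x),
    (fun i => v i + 1); split=> // i; exact: Ex.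
(* At [h = 0] nonnegativity is exactly the calmness hypothesis. *)
- apply: le_trans; rewrite /val.
  rewrite [X in K * X](eq_bigr (fun i => enorm (y i - z))); first exact: calm.
  move=> i _; rewrite (_ : hc _ i = 0) ?sub0r ?enormN//.
  by apply/colP => j; rewrite !mxE.
pose b i : 'cV[R]_n := \col_j a (i, j).
pose P := \sum_i p i.
have P0 : 0 <= P by apply: sumr_ge0 => i _; exact: ltW.
(* The perturbation [h = y - z] cancels the penalty term, so [K] disappears. *)
have bS z y r : (forall i, E i (y i) (r i)) ->
    \sum_i dotv (b i) (y i - z) <= \sum_i p i * (r i - v i) + L * enorm (z - x).
  move=> Eyr; pose h (ij : I * 'I_n) := (y ij.1 - z) ij.2 0.
  have hcE i : hc h i = y i - z by apply/colP => j; rewrite [LHS]mxE.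
  have /aS : S h (val h z y r) by exists z, y, r.
  rewrite /val [X in K * X]big1 => [|i _]; last by rewrite hcE subrr enorm0.
  rewrite mulr0 addr0; apply: le_trans.
  have -> : \sum_j a j * h j = \sum_i \sum_j a (i, j) * h (i, j).
    by rewrite pair_bigA; apply: eq_bigr => -[].
  by apply: ler_sum => i _; apply: ler_sum => j _; rewrite [b i j 0]mxE.
have eps_le (A B : R) : (forall eps, 0 < eps -> A <= B + P * eps) -> A <= B.
  move=> AB; apply/ler_addgt0Pr => eps eps0.
  have P1 : 0 < P + 1 by rewrite ltr_wpDl.
  apply: (le_trans (AB (eps / (P + 1)) (divr_gt0 eps0 P1))).
  by rewrite lerD2l mulrA ler_pdivrMr//; lra.
(* [b i] is a slope of [p i] times the [i]-th function, hence the division. *)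
exists (fun i => (p i)^-1 *: b i); split=> [i y r Eyr|].
  rewrite dotvZl addrC -lerBrDr mulrC ler_pdivrMr// mulrC.
  apply: eps_le => eps eps0.
  (* Only the [i]-th copy leaves [x]. The others sit at height [v k + eps], as a strict epigraph
     does not contain [v k] itself. *)
  have := bS x (fun k => if k == i then y else x)
               (fun k => if k == i then r else v k + eps).
  rewrite subrr enorm0 mulr0 addr0 => /(_ _)/le_trans bS'.
  apply: (le_trans (y := \sum_k dotv (b k) ((if k == i then y else x) - x))).
    rewrite (bigD1 i)//= eqxx big1 ?addr0// => k /negbTE ->.
    by rewrite subrr dotv0r.
  apply: bS' => [k|]; first by case: eqP => [->//|_]; exact: Ex.
  rewrite (bigD1 i)//= eqxx lerD2l /P mulr_suml [leRHS](bigD1 i)//=.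
  rewrite -[leLHS]add0r lerD ?mulr_ge0 ?(ltW eps0) ?(ltW (p0 i))//.
  by apply: ler_sum => k /negbTE ->; rewrite addrAC subrr add0r.
have -> : \sum_i p i *: ((p i)^-1 *: b i) = \sum_i b i.
  by apply: eq_bigr => i _; rewrite scalerA mulfV ?scale1r ?lt0r_neq0.
set g := \sum_i b i.
have : dotv g g <= L * enorm g.
  apply: eps_le => eps eps0.
  (* All copies stay at [x] while [z] moves to [x - g]: every perturbation equals [g], and the only
     costs are [L * enorm g] and a multiple of [eps]. *)
  have := bS (x - g) (fun=> x) (fun i => v i + eps) (fun i => Ex i eps eps0).
  rewrite addrAC subrr add0r enormN opprB.
  rewrite (eq_bigr (fun i => dotv (b i) g)); last first.
    by move=> i _; rewrite addrC subrK.
  rewrite -dotv_suml -/g => /le_trans; apply.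
  rewrite addrC lerD2l /P mulr_suml.
  by apply: ler_sum => k _; rewrite addrAC subrr add0r.
rewrite -sqr_enorm expr2.
have [->|g0] := eqVneq (enorm g) 0; first by [].
by rewrite ler_pM2r// lt_def g0 enorm_ge0.
Qed.

End HahnBanach.

(** * Infimal projections over polyhedral constraints *)

Section InfProjection.
Context (R : realType).

(** Keeping [u] while the state moves to [y'] violates [C] by a multiple of [enorm (y' - y)], and
    [project_system] repairs this by changing [u] only. *)
Lemma lipschitz_selection n m (C : seq ('cV[R]_(n + m) * R)) :
  exists (C1 : seq ('cV[R]_n * R)) (k : R),
  [/\ 0 <= k,
      forall y u, sat C (col_mx y u) -> sat C1 y
    & forall y u y', sat C (col_mx y u) -> sat C1 y' ->
        exists2 u', sat C (col_mx y' u') & enorm (u' - u) <= k * enorm (y' - y)].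
Proof.
have [C1 [k [k0 CC1 C1C]]] := project_system C.
have [N N0 NC] := nearsat_lipschitz C.
exists C1, (k * N); split=> // [|y u y' Cyu C1y']; first by rewrite mulr_ge0.
have Ny0 : 0 <= N * enorm (y' - y) by rewrite mulr_ge0 ?enorm_ge0.
have [|u' Cu' u'u] := C1C y' u _ Ny0 C1y'.
  apply: nearsatS (NC _ (col_mx y' u) _ (sat_nearsat Cyu)).
  rewrite add0r ler_wpM2l// opp_col_mx add_col_mx subrr.
  by apply: (le_trans (enorm_col_mx _ _)); rewrite enorm0 addr0.
by exists u' => //; rewrite -mulrA.
Qed.

(** The hypothesis involving [L] only compares costs at a state [z] common to all [i], whereas
    calmness allows a different state for each [i]. Hoffman's bound supplies a common feasible state
    nearby, and Lipschitz selections carry the controls to it. *)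
Lemma inf_projection_subgradient (I : finType) n m (p v G : I -> R)
    (C : I -> seq ('cV[R]_(n + m) * R)) (g : I -> 'cV[R]_(n + m) -> R)
    (x : 'cV[R]_n) (L : R) :
  0 <= L -> (forall i, 0 < p i) -> (forall i, 0 <= G i) ->
  (forall i z0 z1, sat (C i) z0 -> sat (C i) z1 ->
     g i z1 <= g i z0 + G i * enorm (z1 - z0)) ->
  (forall i z0 z1 (c : R), 0 <= c <= 1 -> sat (C i) z0 -> sat (C i) z1 ->
     g i (c *: z0 + (1 - c) *: z1) <= c * g i z0 + (1 - c) * g i z1) ->
  (forall i (eps : R), 0 < eps ->
     exists2 u, sat (C i) (col_mx x u) & g i (col_mx x u) < v i + eps) ->
  (forall z u, (forall i, sat (C i) (col_mx z (u i))) ->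
     \sum_i p i * v i <=
     \sum_i p i * g i (col_mx z (u i)) + L * enorm (z - x)) ->
  exists a : I -> 'cV[R]_n,
    (forall i y u, sat (C i) (col_mx y u) ->
       v i + dotv (a i) (y - x) <= g i (col_mx y u)) /\
    enorm (\sum_i p i *: a i) <= L.
Proof.
move=> L0 p0 G0 glip gconv gx gL.
have /choice[/= Ck CkP] i : exists Ck : seq ('cV[R]_n * R) * R,
    [/\ 0 <= Ck.2, forall y u, sat (C i) (col_mx y u) -> sat Ck.1 y
    & forall y u y', sat (C i) (col_mx y u) -> sat Ck.1 y' ->
        exists2 u', sat (C i) (col_mx y' u') &
          enorm (u' - u) <= Ck.2 * enorm (y' - y)].
  by have [C1 [k ?]] := lipschitz_selection (C i); exists (C1, k).
have /choice[/= M MP] i : exists M : R, 0 <= M /\ forall y z v,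
    nearsat v (Ck i).1 y -> nearsat (v + M * enorm (z - y)) (Ck i).1 z.
  by have [M ? ?] := nearsat_lipschitz (Ck i).1; exists M.
(* [D] describes the states that are feasible for all [i] at once. *)
pose D := flatten [seq (Ck i).1 | i <- enum I].
have [|k k0 kD] := @hoffman _ _ D.
  exists x; apply/sat_flatten => i.
  by have [u /(let: And3 _ h _ := CkP i in h _ _)] := gx i 1 ltr01.
pose MM := \sum_i M i.
have MM0 : 0 <= MM by apply: sumr_ge0 => i _; have [] := MP i.
have MMi i : M i <= MM.
  by rewrite /MM (bigD1 i)//= lerDl sumr_ge0// => j _; have [] := MP j.
(* The factors are the Lipschitz constant of the cost, the joint displacement of state and control
   per displacement of the state, and the distance from [y i] to the common state per unit of
   [del]. *)
pose H i := G i * (1 + (Ck i).2) * (k * MM + 1).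
have k'0 i : 0 <= (Ck i).2 by have [] := CkP i.
have H0 i : 0 <= H i by rewrite !(mulr_ge0, addr_ge0).
have PH0 : 0 <= \sum_i p i * H i.
  by apply: sumr_ge0 => i _; rewrite mulr_ge0// ltW.
(* The strict inequality expresses that the infimum over [u] is below [r], without requiring that it
   be attained. *)
pose E i y r := exists2 u, sat (C i) (col_mx y u) & g i (col_mx y u) < r.
(* In the constant, [L * (k * MM)] pays for moving [z] to the common state and the sum pays for
   moving the costs there. *)
have [|i y0 r0 y1 r1 c c01 [u0 C0 g0] [u1 C1 g1]||z y r Eyr|a [aE aL]] :=
    @joint_subgradient R I n p v E x L (L * (k * MM) + \sum_i p i * H i) L0 _ p0.
- by rewrite addr_ge0// !mulr_ge0.
- exists (c *: u0 + (1 - c) *: u1).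
    have := sat_convex c01 C0 C1.
    by rewrite !scale_col_mx add_col_mx.
  have := gconv _ _ _ _ c01 C0 C1; rewrite !scale_col_mx add_col_mx => /le_lt_trans.
  have /andP[c0 c1] := c01; apply.
  (* Strictness must come from a point of positive weight: the second one if [c = 0], the first one
     otherwise. *)
  have [->|cn0] := eqVneq c 0.
    by rewrite !mul0r !add0r subr0 !mul1r.
  rewrite ltr_leD//; first by rewrite ltr_pM2l// lt_def cn0.
  by rewrite ler_wpM2l ?subr_ge0// ltW.
- exact: gx.
- have /choice[u uP] i : exists u,
      sat (C i) (col_mx (y i) u) /\ g i (col_mx (y i) u) < r i.
    by have [u ? ?] := Eyr i; exists u.
  pose del := \sum_i enorm (y i - z).
  have del0 : 0 <= del by apply: sumr_ge0 => i _; exact: enorm_ge0.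
  have deli i : enorm (y i - z) <= del.
    by rewrite /del (bigD1 i)//= lerDl sumr_ge0// => j _; exact: enorm_ge0.
  have Md0 : 0 <= MM * del by rewrite mulr_ge0.
  have [|z' Dz' z'z] := kD z _ Md0.
    move=> c /flatten_mapP[i _]; move: c.
    have [_ CCk _] := CkP i; have [Mi0 MiP] := MP i.
    have /sat_nearsat/(MiP _ z) := CCk _ _ (uP i).1.
    apply: nearsatS; rewrite add0r.
    by apply: ler_pM; rewrite ?enorm_ge0// enormB.
  have z'y i : enorm (z' - y i) <= (k * MM + 1) * del.
    apply: (le_trans (enorm_triangle _ z _)); rewrite mulrDl mul1r -mulrA.
    by rewrite lerD// enormB.
  have /choice[u' u'P] i : exists u', sat (C i) (col_mx z' u') /\
      g i (col_mx z' u') <= r i + H i * del.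
    have [_ _ sel] := CkP i; have [Cu gu] := uP i.
    have [|u' Cu' u'u] := sel _ _ z' Cu; first by apply: (sat_flatten _ _).1 Dz' i.
    exists u'; split=> //; apply: (le_trans (glip _ _ _ Cu Cu')).
    rewrite lerD ?(ltW gu)// /H -2!mulrA ler_wpM2l// opp_col_mx add_col_mx.
    apply: (le_trans (enorm_col_mx _ _)).
    rewrite [leRHS]mulrDl mul1r lerD//; apply: (le_trans u'u).
    by rewrite ler_wpM2l.
  have h1 := gL _ _ (fun i => (u'P i).1).
  have h2 : \sum_i p i * g i (col_mx z' (u' i)) <=
      \sum_i p i * r i + (\sum_i p i * H i) * del.
    rewrite mulr_suml -big_split; apply: ler_sum => i _ /=.
    by rewrite -mulrA -mulrDr ler_wpM2l ?(ltW (p0 i))//; exact: (u'P i).2.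
  have h3 : L * enorm (z' - x) <= L * enorm (z - x) + L * (k * MM) * del.
    rewrite -mulrA -mulrDr ler_wpM2l//.
    by apply: (le_trans (enorm_triangle _ z _)); rewrite addrC lerD// -mulrA.
  have -> : \sum_i p i * (r i - v i) = \sum_i p i * r i - \sum_i p i * v i.
    by rewrite -sumrB; apply: eq_bigr => i _; rewrite mulrBr.
  rewrite -/del; move: h1 h2 h3; lra.
- exists a; split=> // i y u Cyu; apply/ler_addgt0Pr => eps eps0.
  by apply: aE; exists u; rewrite ?ltrDl.
Qed.

End InfProjection.

(** * Maxima and suprema of affine functions; slopes at interior points *)

Section ConvexFunctions.
Context (R : realType).

Lemma delta_in (V : Type) (A : set V) z : A z -> delta R A z = 0%E.
Proof. by move=> Az; rewrite /delta; case: asboolP. Qed.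

Lemma delta_out (V : Type) (A : set V) z : ~ A z -> delta R A z = +oo%E.
Proof. by move=> nAz; rewrite /delta; case: asboolP. Qed.

Lemma lt_pinfty_delta (V : Type) (A : set V) z (r : R) :
  (r%:E + delta R A z < +oo)%E <-> A z.
Proof.
split=> [|Az]; last by rewrite delta_in// adde0 ltry.
by apply: contraPP => nAz; rewrite delta_out.
Qed.

Lemma bigmaxe_EFin (I : finType) (f : I -> R) : (0 < #|I|)%N ->
  exists j, [/\ forall i, f i <= f j & \big[maxe/-oo%E]_i (f i)%:E = (f j)%:E].
Proof.
move=> /card_gt0P[i0 _].
case: (@arg_maxP _ _ _ i0 xpredT f) => // j _ fj; exists j.
split=> [i|]; first exact: fj.
apply/eqP; rewrite eq_le; apply/andP; split.
  by apply: bigmax_le => [|i _]; rewrite ?leNye// lee_fin; exact: fj.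
exact: (le_bigmax _ (fun i => (f i)%:E)).
Qed.

Lemma max_affine q (I : finType) (c : I -> 'cV[R]_q) (e : I -> R) :
  (0 < #|I|)%N ->
  exists (g : 'cV[R]_q -> R) (K : R),
  [/\ 0 <= K,
      forall z, \big[maxe/-oo%E]_i (dotv (c i) z + e i)%:E = (g z)%:E,
      forall z0 z1, g z1 <= g z0 + K * enorm (z1 - z0)
    & forall z0 z1 (s : R), 0 <= s <= 1 ->
        g (s *: z0 + (1 - s) *: z1) <= s * g z0 + (1 - s) * g z1].
Proof.
move=> I0.
have /choice[j jP] z := bigmaxe_EFin (fun i => dotv (c i) z + e i) I0.
have jle z i : dotv (c i) z + e i <= dotv (c (j z)) z + e (j z) by have [] := jP z.
exists (fun z => dotv (c (j z)) z + e (j z)), (\sum_i enorm (c i)); split.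
- by apply: sumr_ge0 => i _; exact: enorm_ge0.
- by move=> z; have [] := jP z.
- move=> z0 z1; set i := j z1.
  have h1 : dotv (c i) (z1 - z0) <= (\sum_i enorm (c i)) * enorm (z1 - z0).
    apply: (le_trans (cauchy_schwarz _ _)); rewrite ler_wpM2r ?enorm_ge0//.
    by rewrite (bigD1 i)//= lerDl sumr_ge0// => k _; exact: enorm_ge0.
  by have := jle z0 i; rewrite dotvBr in h1; lra.
- move=> z0 z1 s /andP[s0 s1]; set i := j _.
  rewrite dotvDr !dotvZr.
  have h0 : s * (dotv (c i) z0 + e i) <= s * (dotv (c (j z0)) z0 + e (j z0)).
    by rewrite ler_wpM2l.
  have h1 : (1 - s) * (dotv (c i) z1 + e i) <=
      (1 - s) * (dotv (c (j z1)) z1 + e (j z1)).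
    by rewrite ler_wpM2l ?subr_ge0.
  by move: h0 h1; lra.
Qed.

(** Since all slopes are bounded by [L], finiteness of the supremum at one point of [X] propagates
    to all of [X]; a member of [F] excludes [-oo] and forces [+oo] outside [X]. *)
Lemma sup_of_affine n (X : set 'cV[R]_n) (L : R)
    (F : set ('cV[R]_n -> \bar R)) :
  0 <= L ->
  (forall g, F g -> exists (a : 'cV[R]_n) (b : R), enorm a <= L /\
     g = fun y => ((dotv a y + b)%:E + delta R X y)%E) ->
  F !=set0 -> (exists2 y, X y & (sup_of F y < +oo)%E) ->
  exists g : 'cV[R]_n -> R,
  [/\ forall y, X y -> sup_of F y = (g y)%:E,
      forall y, ~ X y -> sup_of F y = +oo%E,
      forall y z, X y -> X z -> g z <= g y + L * enorm (z - y)
    & forall y z (s : R), 0 <= s <= 1 -> X y -> X z ->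
        X (s *: y + (1 - s) *: z) ->
        g (s *: y + (1 - s) *: z) <= s * g y + (1 - s) * g z].
Proof.
move=> L0 Faff [f0 Ff0] [y0 Xy0 supy0].
have le_sup f y : F f -> (f y <= sup_of F y)%E.
  by move=> Ff; apply: ereal_sup_ubound; exists f.
have sup_le y (r : R) :
    (forall a b, F (fun y => ((dotv a y + b)%:E + delta R X y)%E) ->
       enorm a <= L -> dotv a y + b <= r) -> X y -> (sup_of F y <= r%:E)%E.
  move=> h Xy; apply: ge_ereal_sup => _ [f Ff <-].
  have [a [b [aL fE]]] := Faff f Ff; rewrite fE delta_in// adde0 lee_fin.
  by apply: h => //; rewrite -fE.
have finX y : X y -> sup_of F y \is a fin_num.
  move=> Xy; have [a [b [_ f0E]]] := Faff _ Ff0.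
  have NyF z : X z -> (-oo < sup_of F z)%E.
    by move=> Xz; apply: lt_le_trans (le_sup _ z Ff0); rewrite f0E delta_in// ltNyr.
  rewrite fin_numElt NyF//=.
  have y0fin : sup_of F y0 \is a fin_num by rewrite fin_numElt NyF.
  apply: (@le_lt_trans _ _ (fine (sup_of F y0) + L * enorm (y - y0))%:E);
    last exact: ltry.
  apply: sup_le => // a' b' Fab a'L.
  have := le_sup _ y0 Fab; rewrite delta_in// adde0 -(fineK y0fin) lee_fin.
  have := le_trans (cauchy_schwarz a' (y - y0)) (ler_wpM2r (enorm_ge0 _) a'L).
  by rewrite dotvBr; lra.
have leg a b y : X y -> F (fun y => ((dotv a y + b)%:E + delta R X y)%E) ->
    dotv a y + b <= fine (sup_of F y).
  move=> Xy Fab; rewrite -lee_fin fineK ?finX//.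
  by have := le_sup _ y Fab; rewrite delta_in// adde0.
exists (fine \o sup_of F); split=> [y Xy|y nXy|y z Xy Xz|y z s s01 Xy Xz Xs] /=.
- by rewrite fineK ?finX.
- apply/eqP; rewrite -leye_eq; have := le_sup _ y Ff0.
  by have [a [b [_ ->]]] := Faff _ Ff0; rewrite delta_out.
- rewrite -lee_fin fineK ?finX//; apply: sup_le => // a b Fab aL.
  have := leg _ _ _ Xy Fab.
  have := le_trans (cauchy_schwarz a (z - y)) (ler_wpM2r (enorm_ge0 _) aL).
  by rewrite dotvBr; lra.
- rewrite -lee_fin fineK ?finX//; apply: sup_le => // a b Fab aL.
  have /andP[s0 s1] := s01; have s1' : 0 <= 1 - s by rewrite subr_ge0.
  have := ler_wpM2l s0 (leg _ _ _ Xy Fab).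
  have := ler_wpM2l s1' (leg _ _ _ Xz Fab).
  by rewrite dotvDr !dotvZr; lra.
Qed.

(** Along a small step in direction [a], the affine minorant rises at rate [enorm a] and [f] at rate
    at most [L]. *)
Lemma interior_subgradient_le n (X : set 'cV[R]_n) (L : R)
    (f : 'cV[R]_n -> \bar R) (x a : 'cV[R]_n) :
  0 <= L -> Defs.lipschitz_on L X f -> interior X x ->
  (forall y, X y -> (f x + (dotv a (y - x))%:E <= f y)%E) -> enorm a <= L.
Proof.
move=> L0 [ffin flip] Xx asub.
have X_x : X x by exact: nbhs_singleton.
have [->|a0] := eqVneq (enorm a) 0; first by [].
have ap : 0 < enorm a by rewrite lt_def a0 enorm_ge0.
have /nbhs_ballP[e /= e0 eX] := Xx.
(* Balls are those of the sup norm, which [enorm] dominates; this [k] keeps the step within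
   [e / 2]. *)
pose k := e / 2 / (enorm a).
have k0 : 0 < k by rewrite !divr_gt0.
have coord i : `|a i 0| <= enorm a.
  rewrite -ler_sqr ?nnegrE ?enorm_ge0// real_normK ?num_real// sqr_enorm.
  rewrite /dotv (bigD1 i)//= -expr2 lerDl sumr_ge0// => j _.
  by rewrite -expr2 sqr_ge0.
have Xy : X (x + k *: a).
  apply: eX; split=> // i j.
  rewrite ord1 /ball /= !mxE opprD addNKr normrN normrM (gtr0_norm k0).
  apply: (@le_lt_trans _ _ (k * enorm a)); first by rewrite ler_wpM2l ?(ltW k0).
  by rewrite /k divfK// ltr_pdivrMr//; lra.
have := asub _ Xy; have := flip _ _ Xy X_x.
rewrite -(fineK (ffin _ Xy)) -(fineK (ffin _ X_x)) -EFinB abse_EFin -EFinD !lee_fin.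
have -> : x + k *: a - x = k *: a by rewrite addrAC subrr add0r.
rewrite dotvZr enormZ (gtr0_norm k0) -sqr_enorm.
move=> /(le_trans (ler_norm _)) h1 h2.
have : k * enorm a * enorm a <= k * enorm a * L by move: h1 h2; rewrite expr2; lra.
by rewrite ler_pM2l// mulr_gt0.
Qed.

End ConvexFunctions.

Import DualAddTheory.

(** * Bellman operators and polyhedrality of the state sets *)

Section BellmanOperator.
Context (R : realType) (d : measure_display) (Omega : measurableType d)
  (Pr : probability Omega R) (dW : measure_display) (TW : measurableType dW)
  (n m : nat) (Q : lp_problem Pr TW n m).
Context (hTW : forall w : TW, measurable [set w]) (hQ : linear_polyhedral Q)
  (hsupp : forall t : nat, (1 <= t <= lp_T Q)%N -> finitely_supported (lp_W Q t)).

Local Notation T := (lp_T Q).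
Local Notation noise t := (fset_set (lp_supp Q t)).

Lemma finite_supp t : (t < T)%N -> finite_set (lp_supp Q t).
Proof. by move=> tT; have [] := hsupp (t := t.+1) tT. Qed.

Lemma noiseP t w : (t < T)%N -> (w \in noise t) = (w \in lp_supp Q t).
Proof. by move=> tT; rewrite in_fset_set//; exact: finite_supp. Qed.

Lemma lp_supp_val t (i : noise t) : (t < T)%N -> lp_supp Q t (val i).
Proof. by move=> tT; have := fsvalP i; rewrite noiseP// => /set_mem. Qed.

Lemma lp_p_gt0 t w : lp_supp Q t w -> 0 < lp_p Q t w.
Proof.
move=> w0; apply: fine_gt0; apply/andP; split=> //.
apply: (le_lt_trans _ (ltry 1)); apply: probability_le1.
exact: measurable_funPTI.
Qed.

Lemma lp_supp_sumE (V : nmodType) t (f : TW -> V) : (t < T)%N ->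
  \sum_(w \in lp_supp Q t) f w = \sum_(i : noise t) f (val i).
Proof.
by move=> tT; rewrite fsbig_finite ?big_seq_fsetE//; exact: finite_supp.
Qed.

Lemma bellman_sumE t phi y : (t < T)%N -> bellman Q t phi y =
  (\sum_(i : noise t) ((lp_p Q t (val i))%:E * bellman_w Q t (val i) phi y)%E)%dE.
Proof.
move=> tT; rewrite /bellman fsbig_finite ?big_seq_fsetE//; exact: finite_supp.
Qed.

Lemma bellman_ge t phi y (b : TW -> R) : (t < T)%N ->
  (forall w, lp_supp Q t w -> ((b w)%:E <= bellman_w Q t w phi y)%E) ->
  ((\sum_(w \in lp_supp Q t) lp_p Q t w * b w)%:E <= bellman Q t phi y)%E.
Proof.
move=> tT bB; rewrite bellman_sumE// lp_supp_sumE// -dsumEFin.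
elim/big_rec2: _ => // i z1 z2 _ z12; apply: lee_dD => //.
have iS := lp_supp_val i tT; rewrite EFinM lee_wpmul2l ?bB//.
by rewrite lee_fin ltW// lp_p_gt0.
Qed.

Lemma bellman_le t phi y (b : noise t -> R) : (t < T)%N ->
  (forall i, (bellman_w Q t (val i) phi y <= (b i)%:E)%E) ->
  (bellman Q t phi y <= (\sum_i lp_p Q t (val i) * b i)%:E)%E.
Proof.
move=> tT bB; rewrite bellman_sumE// -dsumEFin.
elim/big_rec2: _ => // i z1 z2 _ z12; apply: lee_dD => //.
rewrite EFinM lee_wpmul2l//.
by rewrite lee_fin ltW// lp_p_gt0//; exact: lp_supp_val.
Qed.

Lemma bellman_eq t phi y (b : TW -> R) : (t < T)%N ->
  (forall w, lp_supp Q t w -> bellman_w Q t w phi y = (b w)%:E) ->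
  bellman Q t phi y = (\sum_(w \in lp_supp Q t) lp_p Q t w * b w)%:E.
Proof.
move=> tT bB; apply/eqP; rewrite eq_le bellman_ge ?andbT// => [|w /bB -> //].
rewrite lp_supp_sumE//; apply: bellman_le => // i.
by rewrite bB//; exact: lp_supp_val.
Qed.

(** A noise value without a control of finite cost contributes [+oo] with positive weight, and dual
    addition lets [+oo] absorb all other terms. *)
Lemma bellman_outside t phi y : (t < T)%N -> ~ stateX Q t y ->
  bellman Q t phi y = +oo%E.
Proof.
move=> tT; rewrite /stateX tT => /existsNP[w /not_implyP[wS wy]].
have wn : w \in noise t by rewrite noiseP//; exact: mem_set.
have wB : bellman_w Q t w phi y = +oo%E.
  apply/eqP; rewrite -leye_eq; apply: le_ereal_inf_tmp => _ [u _ <-].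
  suff -> : cost Q t w y u = +oo%E by rewrite daddye.
  apply/eqP; rewrite -leye_eq leNgt; apply/negP => yu; apply: wy; by exists u.
by rewrite bellman_sumE// (bigD1 [` wn]%fset)//= wB gt0_muley ?lte_fin ?lp_p_gt0.
Qed.

Lemma final_costP : exists (g : 'cV[R]_n -> R),
  (forall x, final_cost Q x = ((g x)%:E + delta R (lp_XT Q) x)%E) /\
  forall z0 z1 (s : R), 0 <= s <= 1 ->
    g (s *: z0 + (1 - s) *: z1) <= s * g z0 + (1 - s) * g z1.
Proof.
have [_ hI _ _ _] := hQ.
have [g [K [_ gE _ gconv]]] := max_affine (@lp_cT _ _ _ _ _ _ _ _ Q)
  (@lp_dT _ _ _ _ _ _ _ _ Q) (hI T (leqnn _)).
by exists g; split=> // x; rewrite /final_cost gE.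
Qed.

Lemma costP t w : (t < T)%N -> exists (g : 'cV[R]_(n + m) -> R) (K : R),
  [/\ 0 <= K,
      forall x u, cost Q t w x u =
        ((g (col_mx x u))%:E + delta R (lp_P Q t w) (col_mx x u))%E,
      forall z0 z1, g z1 <= g z0 + K * enorm (z1 - z0)
    & forall z0 z1 (s : R), 0 <= s <= 1 ->
        g (s *: z0 + (1 - s) *: z1) <= s * g z0 + (1 - s) * g z1].
Proof.
have [_ hI _ _ _] := hQ => tT.
have [g [K [K0 gE glip gconv]]] := max_affine
  (fun i => @lp_c _ _ _ _ _ _ _ _ Q t i w)
  (fun i => @lp_d _ _ _ _ _ _ _ _ Q t i w) (hI t (ltnW tT)).
by exists g, K; split=> // x u; rewrite /cost gE.
Qed.

Lemma stateT_final x : stateX Q T x <-> lp_XT Q x.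
Proof.
rewrite /stateX ltnn /edom /=; have [g [gE _]] := final_costP.
by rewrite gE; exact: lt_pinfty_delta.
Qed.

(** Before the final stage the state set is a finite intersection, over the noise support, of
    projections of polyhedra. *)
Lemma stateX_system t : (t <= T)%N ->
  exists C : seq ('cV[R]_n * R), forall x, stateX Q t x <-> sat C x.
Proof.
have [_ _ hP _ [hXT _]] := hQ.
rewrite leq_eqVlt => /orP[/eqP ->|tT].
  have [C CP] := polyhedron_system hXT; exists C => x.
  by rewrite -CP; exact: stateT_final.
have /choice[C CP] (i : noise t) : exists C1 : seq ('cV[R]_n * R), forall x,
    (exists u, (cost Q t (val i) x u < +oo)%E) <-> sat C1 x.
  have [C CP] := polyhedron_system (hP t (val i) tT (lp_supp_val i tT)).
  have [g [_ [_ gE _ _]]] := costP (val i) tT.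
  have [C1 C1P] := projection_system C; exists C1 => x; rewrite -C1P.
  split=> -[u]; first by rewrite gE => /lt_pinfty_delta/CP; exists u.
  by exists u; rewrite gE; apply/lt_pinfty_delta/CP.
exists (flatten [seq C i | i <- enum {: noise t}]) => x.
rewrite sat_flatten /stateX tT; split=> [Xx i|Cx w wS].
  by apply/CP; apply: Xx; exact: lp_supp_val.
have wn : w \in noise t by rewrite noiseP//; exact: mem_set.
exact/(CP [` wn]%fset).
Qed.

End BellmanOperator.

(** * Subgradients of the stage problems and the resulting cuts *)

Section SDDPCuts.
Context (R : realType) (d : measure_display) (Omega : measurableType d)
  (Pr : probability Omega R) (dW : measure_display) (TW : measurableType dW)
  (n m : nat) (Q : lp_problem Pr TW n m) (L : nat -> R).
Context (hTW : forall w : TW, measurable [set w]) (hQ : linear_polyhedral Q)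
  (hsupp : forall t : nat, (1 <= t <= lp_T Q)%N -> finitely_supported (lp_W Q t))
  (hU : forall (t : nat) (w : TW) (x : 'cV[R]_n), (t < lp_T Q)%N ->
     lp_supp Q t w -> stateX Q t x ->
     controlU Q t w x !=set0 /\ compact (controlU Q t w x))
  (hL : lipschitz_constants Q L).

Local Notation T := (lp_T Q).
Local Notation noise t := (fset_set (lp_supp Q t)).

Lemma admissible_sup t F : (t < T)%N -> admissible Q L t F ->
  exists g : 'cV[R]_n -> R,
  [/\ forall y, stateX Q t.+1 y -> sup_of F y = (g y)%:E,
      forall y, ~ stateX Q t.+1 y -> sup_of F y = +oo%E,
      forall y z, stateX Q t.+1 y -> stateX Q t.+1 z ->
        g z <= g y + L t.+1 * enorm (z - y)
    & forall y z (s : R), 0 <= s <= 1 -> stateX Q t.+1 y -> stateX Q t.+1 z ->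
        g (s *: y + (1 - s) *: z) <= s * g y + (1 - s) * g z].
Proof.
move=> tT [Fb F0 Fy]; have [L0 _ _] := hL.
have [g [gE gout glip gconv]] := sup_of_affine (ltW (L0 t.+1 tT)) Fb F0 Fy.
exists g; split=> // y z s s01 Xy Xz; apply: gconv => //.
have [C CP] := stateX_system hQ hsupp tT.
by apply/CP; apply: sat_convex => //; exact/CP.
Qed.

(** [sup_of F] is [+oo] off the next state set and [L t.+1]-Lipschitz on it, as the propagation
    property of [L] requires. *)
Lemma admissible_lipschitz t F : (t < T)%N -> admissible Q L t F ->
  Defs.lipschitz_on (L t) (stateX Q t) (bellman Q t (sup_of F)).
Proof.
move=> tT aF; have [g [gE gout glip _]] := admissible_sup tT aF.
have [_ _ hB] := hL; apply: hB => //; split=> [y Xy|y z Xy Xz].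
  by rewrite gE.
rewrite !gE// -EFinB abse_EFin lee_fin ler_norml.
have := glip _ _ Xy Xz; have := glip _ _ Xz Xy; rewrite (enormB z y).
by move=> h1 h2; apply/andP; split; lra.
Qed.

(** The graph of [controlU] is polyhedral: it intersects the polyhedron of the cost with the
    preimage of the next state set under the linear dynamics. *)
Lemma stage_costP t F w : (t < T)%N -> lp_supp Q t w -> admissible Q L t F ->
  exists (C : seq ('cV[R]_(n + m) * R)) (g : 'cV[R]_(n + m) -> R) (K : R),
  [/\ 0 <= K,
      forall x u, sat C (col_mx x u) <-> controlU Q t w x u,
      forall x u, (cost Q t w x u + sup_of F (dynamics Q t w x u))%dE =
        if `[< controlU Q t w x u >] then (g (col_mx x u))%:E else +oo%E,
      forall z0 z1, sat C z0 -> sat C z1 -> g z1 <= g z0 + K * enorm (z1 - z0)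
    & forall z0 z1 (s : R), 0 <= s <= 1 -> sat C z0 -> sat C z1 ->
        g (s *: z0 + (1 - s) *: z1) <= s * g z0 + (1 - s) * g z1].
Proof.
move=> tT wS aF; have [L0 _ _] := hL.
have [phi [phiE phiout philip phiconv]] := admissible_sup tT aF.
have [c [K [K0 cE clip cconv]]] := costP hQ w tT.
have [_ _ hP _ _] := hQ.
have [CP CPP] := polyhedron_system (hP t w tT wS).
have [CX CXP] := stateX_system hQ hsupp tT.
pose M := row_mx (lp_A Q t w) (lp_B Q t w).
have dynE x u : dynamics Q t w x u = M *m col_mx x u by rewrite mul_row_col.
have [CM CMP] := preimage_system M CX.
have [k k0 kM] := enorm_mulmx M.
have CX_M z : sat (CP ++ CM) z -> stateX Q t.+1 (M *m z).
  by move=> /sat_cat[_ /CMP/CXP].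
exists (CP ++ CM), (fun z => c z + phi (M *m z)), (K + L t.+1 * k); split.
- by rewrite addr_ge0// mulr_ge0// ltW// L0.
- move=> x u; rewrite sat_cat /controlU /= cE lt_pinfty_delta CPP dynE.
  by split=> -[? ?]; split=> //; [apply/CXP/CMP|apply/CMP/CXP].
- move=> x u; case: asboolP => [[xu Xu]|].
    rewrite phiE// -dynE; move: xu; rewrite cE => /lt_pinfty_delta xu.
    by rewrite delta_in// adde0.
  (* For an infeasible pair one summand is [+oo], and dual addition makes it win even against
     [-oo]. *)
  move=> /not_andP[|nX]; last by rewrite phiout// daddey.
  move=> /negP; rewrite -leNgt leye_eq => /eqP ->; exact: daddye.
- move=> z0 z1 /CX_M X0 /CX_M X1.
  have h1 := clip z0 z1; have h2 := philip _ _ X0 X1.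
  have : L t.+1 * enorm (M *m z1 - M *m z0) <= L t.+1 * (k * enorm (z1 - z0)).
    by rewrite ler_wpM2l ?(ltW (L0 _ tT))// -mulmxBr.
  by move: h1 h2; lra.
- move=> z0 z1 s s01 /CX_M X0 /CX_M X1.
  rewrite mulmxDr -!scalemxAr.
  by have := cconv z0 z1 s s01; have := phiconv _ _ _ s01 X0 X1; lra.
Qed.

(** Applies [inf_projection_subgradient] with the noise support as index set; Lipschitz continuity
    of the average on [stateX Q t] is the estimate at a common state. *)
Lemma stage_subgradients t F x : (t < T)%N -> admissible Q L t F ->
  stateX Q t x ->
  exists (a : TW -> 'cV[R]_n) (b : TW -> R),
    (forall w, lp_supp Q t w -> bellman_w Q t w (sup_of F) x = (b w)%:E /\
       subgradient (bellman_w Q t w (sup_of F)) x (a w)) /\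
    enorm (\sum_(w \in lp_supp Q t) lp_p Q t w *: a w) <= L t.
Proof.
move=> tT aF Xx; have [L0 _ _] := hL.
have [Bfin Blip] := admissible_lipschitz tT aF.
pose B w := bellman_w Q t w (sup_of F).
have /choice[Z ZP] (i : noise t) :
    exists Z : seq ('cV[R]_(n + m) * R) * ('cV[R]_(n + m) -> R) * R,
  [/\ 0 <= Z.2,
      forall x u, sat Z.1.1 (col_mx x u) <-> controlU Q t (val i) x u,
      forall x u, (cost Q t (val i) x u + sup_of F (dynamics Q t (val i) x u))%dE =
        if `[< controlU Q t (val i) x u >] then (Z.1.2 (col_mx x u))%:E else +oo%E,
      forall z0 z1, sat Z.1.1 z0 -> sat Z.1.1 z1 ->
        Z.1.2 z1 <= Z.1.2 z0 + Z.2 * enorm (z1 - z0)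
    & forall z0 z1 (s : R), 0 <= s <= 1 -> sat Z.1.1 z0 -> sat Z.1.1 z1 ->
        Z.1.2 (s *: z0 + (1 - s) *: z1) <= s * Z.1.2 z0 + (1 - s) * Z.1.2 z1].
  have [C [g [K ?]]] := stage_costP tT (lp_supp_val hsupp i tT) aF.
  by exists (C, g, K).
pose C i := (Z i).1.1; pose g i := (Z i).1.2; pose G i := (Z i).2.
have CU i y u : sat (C i) (col_mx y u) <-> controlU Q t (val i) y u.
  by have [] := ZP i.
have B_le i y u : sat (C i) (col_mx y u) -> (B (val i) y <= (g i (col_mx y u))%:E)%E.
  move=> /CU yu; apply: ereal_inf_lbound; exists u => //.
  by have [_ _ -> _ _] := ZP i; case: asboolP.
have B_lt i y (r : \bar R) : (B (val i) y < r)%E ->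
    exists2 u, sat (C i) (col_mx y u) & ((g i (col_mx y u))%:E < r)%E.
  move=> /ereal_inf_lt[_ [u _ <-]]; have [_ _ -> _ _] := ZP i.
  case: asboolP => [/CU yu ?|_]; first by exists u.
  by move=> /lt_le_trans/(_ (leey _)); rewrite ltxx.
have B_ge i y (r : \bar R) :
    (forall u, sat (C i) (col_mx y u) -> (r <= (g i (col_mx y u))%:E)%E) ->
    (r <= B (val i) y)%E.
  move=> h; rewrite leNgt; apply/negP => /B_lt[u /h].
  by rewrite leNgt => /negP.
have Bx_lty (i : noise t) : (B (val i) x < +oo)%E.
  have [[u /CU/B_le +] _] := hU tT (lp_supp_val hsupp i tT) Xx.
  by move=> /le_lt_trans; apply; exact: ltry.
(* No term is [+oo]. If the [i]-th were [-oo], it could be bounded by any real: [r] is chosen to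
   bound the average by its own value minus 1. *)
have Bx_fin (i : noise t) : B (val i) x \is a fin_num.
  rewrite fin_numElt Bx_lty andbT ltNye; apply/negP => /eqP BNy.
  have p0 : 0 < lp_p Q t (val i) by apply: lp_p_gt0 => //; exact: lp_supp_val.
  pose s := \sum_(j : noise t | j != i) lp_p Q t (val j) * fine (B (val j) x).
  pose r := fine (bellman Q t (sup_of F) x) - s - 1.
  pose b (j : noise t) := if j == i then r / lp_p Q t (val j)
    else fine (B (val j) x).
  have : (bellman Q t (sup_of F) x <= (\sum_j lp_p Q t (val j) * b j)%:E)%E.
    apply: bellman_le => // j; rewrite /b; case: eqP => [->|_].
      by rewrite -/(B (val i) x) BNy leNye.
    have := Bx_lty j; rewrite -/(B (val j) x).
    by case: (B (val j) x) => //= _; rewrite leNye.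
  rewrite -(fineK (Bfin _ Xx)) lee_fin (bigD1 i)//= {1}/b eqxx mulrC.
  rewrite divfK ?lt0r_neq0// (eq_bigr (fun j : noise t =>
    lp_p Q t (val j) * fine (B (val j) x))).
    by rewrite -/s /r; lra.
  by move=> j /negbTE ji; rewrite /b ji.
have BxE (i : noise t) : B (val i) x = (fine (B (val i) x))%:E by rewrite fineK.
have [|||||||a [aP aL]] := @inf_projection_subgradient R (noise t : finType) n m
    (fun i => lp_p Q t (val i)) (fun i => fine (B (val i) x)) G C g x (L t).
- by rewrite ltW// L0// ltnW.
- by move=> i; apply: lp_p_gt0 => //; exact: lp_supp_val.
- by move=> i; have [] := ZP i.
- by move=> i; have [] := ZP i.
- by move=> i; have [] := ZP i.
- move=> i eps eps0; have [|u Cu gu] := @B_lt i x (fine (B (val i) x) + eps)%:E.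
    by rewrite {1}BxE lte_fin ltrDl.
  by exists u; rewrite -?lte_fin.
- move=> z u Czu.
  (* Having a feasible control for every noise value places [z] in the state set, where the
     Lipschitz estimate holds. *)
  have Xz : stateX Q t z.
    rewrite /stateX tT => w wS.
    have wn : w \in noise t by rewrite noiseP//; exact: mem_set.
    by have /CU[? _] := Czu [` wn]%fset; exists (u [` wn]%fset).
  have := Blip _ _ Xx Xz; rewrite -(fineK (Bfin _ Xx)) -(fineK (Bfin _ Xz)).
  rewrite -EFinB abse_EFin lee_fin enormB => /(le_trans (ler_norm _)).
  have : (bellman Q t (sup_of F) z <=
      (\sum_i lp_p Q t (val i) * g i (col_mx z (u i)))%:E)%E.
    by apply: bellman_le => // i; exact: B_le.
  rewrite -{1}(fineK (Bfin _ Xz)) lee_fin.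
  rewrite (@bellman_eq _ _ _ _ _ _ _ _ _ hTW hsupp t (sup_of F) x (fun w => fine (B w x)))//.
    by rewrite (lp_supp_sumE hsupp)//=; lra.
  move=> w wS; have wn : w \in noise t by rewrite noiseP//; exact: mem_set.
  exact: (BxE [` wn]%fset).
pose a' w := if insub w is Some i then a i else 0.
have a'E (i : noise t) : a' (val i) = a i by rewrite /a' valK.
exists a', (fun w => fine (B w x)); split.
  move=> w wS; have wn : w \in noise t by rewrite noiseP//; exact: mem_set.
  have /= Bfinw := Bx_fin [` wn]%fset.
  split; first by rewrite fineK.
  split=> // y; apply: (@B_ge [` wn]%fset) => u Cu.
  rewrite -/(B w) -(fineK Bfinw) -EFinD lee_fin.
  by have := aP _ _ _ Cu; rewrite -a'E.
rewrite (lp_supp_sumE hsupp)//; under eq_bigr do rewrite a'E.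
exact: aL.
Qed.

(** The case of a single index in [joint_subgradient], with calmness following from Lipschitz
    continuity and the triangle inequality. *)
Lemma final_subgradient x : stateX Q T x ->
  exists2 a, subgradient (final_cost Q) x a & enorm a <= L T.
Proof.
move=> /(stateT_final hQ) Xx; have [L0 [_ lipT] _] := hL.
have [_ _ _ _ [/polyhedron_system[C CP] _]] := hQ.
have [g [gE gconv]] := final_costP hQ.
have L0T := ltW (L0 T (leqnn _)).
have glip y z : lp_XT Q y -> lp_XT Q z -> g y <= g z + L T * enorm (y - z).
  move=> Xy Xz; have := lipT y z ((stateT_final hQ _).2 Xy) ((stateT_final hQ _).2 Xz).
  rewrite !gE !delta_in// !adde0 -EFinB abse_EFin lee_fin.
  by move=> /(le_trans (ler_norm _)); lra.
pose E (_ : 'I_1) y r := lp_XT Q y /\ g y <= r.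
have [//|i y0 r0 y1 r1 c c01 [X0 g0] [X1 g1]|i eps eps0|z y r Eyr|a [aP aL]] :=
  @joint_subgradient R 'I_1 n (fun=> 1) (fun=> g x) E x (L T) (L T) L0T L0T.
- split; first by apply/CP; apply: sat_convex => //; exact/CP.
  apply: (le_trans (gconv _ _ _ c01)); have /andP[c0 c1] := c01.
  by rewrite lerD// ler_wpM2l ?subr_ge0.
- by split=> //; rewrite lerDl ltW.
- rewrite !big_ord1 mul1r; have [Xy gy] := Eyr ord0.
  have := glip _ _ Xx Xy.
  have := ler_wpM2l L0T (enorm_triangle x z (y ord0)).
  rewrite (enormB x z) (enormB z (y ord0)); lra.
rewrite big_ord1 scale1r in aL; exists (a ord0) => //.
split=> [|y]; rewrite !gE (delta_in _ Xx) adde0//.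
have [Xy|nXy] := pselect (lp_XT Q y); last by rewrite delta_out// addey// leey.
rewrite delta_in// adde0 -EFinD lee_fin; exact: (aP ord0 y (g y)).
Qed.

Lemma cut_basic t a x b : enorm a <= L t -> basic Q L t (Defs.cut Q t a x b).
Proof.
move=> aL; exists a, (b - dotv a x); split=> //.
by apply/funext => y; rewrite /Defs.cut dotvBr addrAC addrA.
Qed.

Lemma cut_at t a x b : stateX Q t x -> Defs.cut Q t a x b x = b%:E.
Proof. by move=> Xx; rewrite /Defs.cut subrr dotv0r add0r delta_in// adde0. Qed.

Lemma cut_inside t a x b y : stateX Q t y ->
  Defs.cut Q t a x b y = (b + dotv a (y - x))%:E.
Proof. by move=> Xy; rewrite /Defs.cut delta_in// adde0 addrC. Qed.

Lemma final_cut_tight_valid x g : stateX Q T x -> sddp_cutT Q x g ->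
  g x = value Q T x /\ forall y, (g y <= value Q T y)%E.
Proof.
rewrite /value subnn /= => Xx [a [b [[_ asub] fx ->]]].
split=> [|y]; first by rewrite cut_at.
have [Xy|nXy] := pselect (stateX Q T y).
  by rewrite cut_inside// EFinD -fx.
move: (nXy); rewrite /stateX ltnn /edom /= => /negP; rewrite -leNgt.
by apply: le_trans; exact: leey.
Qed.

Lemma sddp_cut_minorant t F x (a : TW -> 'cV[R]_n) (b : TW -> R) y : (t < T)%N ->
  (forall w, lp_supp Q t w -> bellman_w Q t w (sup_of F) x = (b w)%:E /\
     subgradient (bellman_w Q t w (sup_of F)) x (a w)) ->
  ((\sum_(w \in lp_supp Q t) lp_p Q t w * b w +
    dotv (\sum_(w \in lp_supp Q t) lp_p Q t w *: a w) (y - x))%:E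
     <= bellman Q t (sup_of F) y)%E.
Proof.
move=> tT ab.
have -> : \sum_(w \in lp_supp Q t) lp_p Q t w * b w +
    dotv (\sum_(w \in lp_supp Q t) lp_p Q t w *: a w) (y - x) =
    \sum_(w \in lp_supp Q t) lp_p Q t w * (b w + dotv (a w) (y - x)).
  rewrite !(lp_supp_sumE hsupp)// dotv_suml -big_split; apply: eq_bigr => i _ /=.
  by rewrite dotvZl mulrDr.
apply: bellman_ge => // w wS; have [bw [_ aw]] := ab w wS.
by rewrite EFinD -bw.
Qed.

Lemma sddp_cut_tight_valid t F x g : (t < T)%N -> stateX Q t x ->
  sddp_cut Q t F x g ->
  g x = bellman Q t (sup_of F) x /\ forall y, (g y <= bellman Q t (sup_of F) y)%E.
Proof.
move=> tT Xx [a [b [ab ->]]]; split=> [|y].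
  by rewrite cut_at// (bellman_eq hTW hsupp tT (fun w wS => (ab w wS).1)).
(* Off the state set the Bellman function is [+oo], so the cut cannot exceed it. *)
have [Xy|nXy] := pselect (stateX Q t y).
  by rewrite cut_inside//; exact: sddp_cut_minorant.
by rewrite (bellman_outside hTW hsupp)// leey.
Qed.

(** Whatever subgradients are chosen, the averaged slope supports the averaged function, which is
    [L t]-Lipschitz around an interior point. *)
Lemma sddp_cut_basic_interior t F x g : (t < T)%N -> admissible Q L t F ->
  interior (stateX Q t) x -> sddp_cut Q t F x g -> basic Q L t g.
Proof.
move=> tT aF Xx [a [b [ab ->]]]; have [L0 _ _] := hL; apply: cut_basic.
apply: (interior_subgradient_le _ (admissible_lipschitz tT aF) Xx).
  by rewrite ltW// L0// ltnW.
move=> y _; rewrite (bellman_eq hTW hsupp tT (fun w wS => (ab w wS).1)).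
by rewrite -EFinD; exact: sddp_cut_minorant.
Qed.

Lemma final_cut_basic_interior x g :
  interior (stateX Q T) x -> sddp_cutT Q x g -> basic Q L T g.
Proof.
move=> Xx [a [b [[_ asub] _ ->]]]; have [L0 lipT _] := hL; apply: cut_basic.
apply: (interior_subgradient_le _ lipT Xx) => [|y _]; last exact: asub.
by rewrite ltW// L0.
Qed.

End SDDPCuts.

(** At a boundary point of the state set subgradients can be arbitrarily large. The slope bound is
    therefore proved for every choice at interior points, and for a suitable choice at all
    points. *)
Theorem proposition14 (R : realType) (d : measure_display)
  (Omega : measurableType d) (Pr : probability Omega R)
  (dW : measure_display) (TW : measurableType dW)
  (n m : nat) (Q : lp_problem Pr TW n m) (L : nat -> R)
  (hTW : forall w : TW, measurable [set w])
  (hQ : linear_polyhedral Q)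
  (hsupp : forall t : nat, (1 <= t <= lp_T Q)%N ->
     finitely_supported (lp_W Q t))
  (hindep : independent_noises (lp_T Q) (lp_W Q))
  (hX : forall t : nat, (t <= lp_T Q)%N ->
     stateX Q t !=set0 /\ compact (stateX Q t))
  (hU : forall (t : nat) (w : TW) (x : 'cV[R]_n), (t < lp_T Q)%N ->
     lp_supp Q t w -> stateX Q t x ->
     controlU Q t w x !=set0 /\ compact (controlU Q t w x))
  (hL : lipschitz_constants Q L) :
  [/\ (* t = T *)
      (forall S, sddp_mapT Q S ->
         tight_validT Q S /\
         forall x : 'cV[R]_n, interior (stateX Q (lp_T Q)) x ->
           basic Q L (lp_T Q) (S x)),
      (exists S, sddp_mapT Q S /\ selectionT Q L S)
    & (* t < T *)
      forall t : nat, (t < lp_T Q)%N ->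
        (forall S, sddp_map Q L t S ->
           tight_valid Q L t S /\
           forall (F : set ('cV[R]_n -> \bar R)) (x : 'cV[R]_n),
             admissible Q L t F -> interior (stateX Q t) x ->
             basic Q L t (S F x)) /\
        (exists S, sddp_map Q L t S /\ selection Q L t S)].
Proof.
split=> [S hS|| t tT].
- split=> [x Xx|x Xx]; first by apply: final_cut_tight_valid => //; exact: hS.
  by apply: (final_cut_basic_interior hL Xx); apply: hS; exact: interior_subset.
(* The zero function is a default value outside the state set. *)
- have /choice[S hS] x : exists g, stateX Q (lp_T Q) x ->
      sddp_cutT Q x g /\ basic Q L (lp_T Q) g.
    have [Xx|nXx] := pselect (stateX Q (lp_T Q) x); last by exists (fun=> 0%E).
    have [a asub aL] := final_subgradient hQ hL Xx.
    exists (Defs.cut Q (lp_T Q) a x (fine (final_cost Q x))) => _.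
    split; last exact: cut_basic.
    exists a, (fine (final_cost Q x)); split=> //.
    by rewrite fineK//; case: asub.
  exists S; split=> [x /hS[]//|]; split=> [x /hS[]//|x Xx].
  by apply: final_cut_tight_valid => //; have [] := hS x Xx.
- split=> [S hS|].
    split=> [F x aF Xx|F x aF Xx].
      by apply: sddp_cut_tight_valid => //; exact: hS.
    apply: (sddp_cut_basic_interior hTW hQ hsupp hL tT aF Xx).
    by apply: hS => //; exact: interior_subset.
  have /choice[S hS] (Fx : set ('cV[R]_n -> \bar R) * 'cV[R]_n) : exists g,
      admissible Q L t Fx.1 -> stateX Q t Fx.2 ->
      sddp_cut Q t Fx.1 Fx.2 g /\ basic Q L t g.
    have [[aF Xx]|nFx] := pselect (admissible Q L t Fx.1 /\ stateX Q t Fx.2);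
      last by exists (fun=> 0%E) => aF Xx; case: nFx.
    have [a [b [ab aL]]] := stage_subgradients hTW hQ hsupp hU hL tT aF Xx.
    exists (Defs.cut Q t (\sum_(w \in lp_supp Q t) lp_p Q t w *: a w) Fx.2
      (\sum_(w \in lp_supp Q t) lp_p Q t w * b w)) => _ _.
    by split; [exists a, b|exact: cut_basic].
  exists (fun F x => S (F, x)); split=> [F x aF Xx|].
    by have [] := hS (F, x) aF Xx.
  split=> F x aF Xx; have [] // := hS (F, x) aF Xx.
  by move=> /(sddp_cut_tight_valid hTW hsupp tT Xx).
Qed.
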